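(* There exist events $\Omega_N$, $N\in\mathbb{N}$ (not depending on $t$), such that for some $\eta>0$ $$\mathbb{P}\{\Omega_N^{\mathrm{c}}\}\leqslant e^{-\eta(\log N)^2},$$ while on $\Omega_N$, for all $t\in[0,T]$, $$\mu_N(t)=\mathbb{E}\{\mu_N(t)\}+\frac1N\sum_{i,j=1}^N\big(a_{i,j}(t)-p(t)\big)+\mathcal{G}_N(t)\left(\frac{(\log N)^4}{\sqrt N}\right),$$ for some (random) $\mathcal{G}_N(t)$ such that $\limsup_{N\to\infty}\sup_{t\in[0,T]}|\mathcal{G}_N(t)|$ is finite almost surely.
   Context: Fix $T>0$, $p(0)\in(0,1)$, $\lambda_{\mathrm{on}}>0$ and $\lambda_{\mathrm{off}}>0$, all independent of $N$. For each $N\in\mathbb{N}$ consider the dynamic Erdős–Rényi random graph on $N$ vertices (self-loops allowed) with symmetric adjacency matrix process $A_N(t)=(a_{i,j}(t))_{i,j=1}^N$, $t\in[0,T]$, where $a_{i,j}(t)=a_{j,i}(t)\in\{0,1\}$, and the processes $(a_{i,j}(t))_{t\in[0,T]}$ with $1\leqslant i\leqslant j\leqslant N$ are independent and identically distributed càdlàg processes: $a_{i,j}(0)=1$ with probability $p(0)$ and $a_{i,j}(0)=0$ with probability $1-p(0)$; afterwards the process alternates between the values 1 and 0, each sojourn at 1 being exponentially distributed with parameter $\lambda_{\mathrm{on}}$ and each sojourn at 0 being exponentially distributed with parameter $\lambda_{\mathrm{off}}$, all sojourn times and the initial state being independent (so $a_{i,j}$ is a two-state continuous-time Markov chain). The graphs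 for all $N$ are taken to be defined on a common probability space. $p(t):=\mathbb{P}\{a_{i,j}(t)=1\}$; explicitly $p(t)=\varrho+\big((1-\varrho)p(0)-\varrho(1-p(0))\big)e^{-(\lambda_{\mathrm{on}}+\lambda_{\mathrm{off}})t}$ with $\varrho:=\lambda_{\mathrm{off}}/(\lambda_{\mathrm{on}}+\lambda_{\mathrm{off}})$. $\mu_N(t)$ denotes the principal (largest) eigenvalue of $A_N(t)$. *)

(* Defs.v *)
From HB Require Import structures.
From mathcomp Require Import all_boot all_order all_algebra.
From mathcomp Require Import all_classical all_reals all_analysis.

Set Implicit Arguments.
Unset Strict Implicit.
Unset Printing Implicit Defensive.

Import Order.TTheory GRing.Theory Num.Theory.
Import numFieldNormedType.Exports.

Local Open Scope classical_set_scope.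
Local Open Scope ring_scope.

Section Independence.
Context {R : realType} {d : measure_display} {Omega : measurableType d}.
Variable P : probability Omega R.

(* Mutual independence of an arbitrary family of classes of events; it is used
   below with sigma-algebras. *)
Definition mutually_independent {I : eqType} (F : I -> set (set Omega)) :=
  forall (J : seq I) (E : I -> set Omega), uniq J ->
    (forall i, i \in J -> F i (E i)) ->
    P (\bigcap_(i in [set` J]) E i) = (\prod_(i <- J) P (E i))%E.

End Independence.

Section OnOffProcess.
Context {R : realType} {d : measure_display} {Omega : measurableType d}.
Variables (P : probability Omega R) (T p0 lon loff : R).

Definition cadlag (f : R -> R) :=
  (forall t, t \in `[0, T[ -> f @ t^'+ --> f t) /\
  (forall t, t \in `]0, T] -> cvg (f @ t^'-)).

(* [S true k] and [S false k] are the lengths of the k-th sojourn at 1 and of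
   the k-th sojourn at 0 (k = 0, 1, ...). For a path started in state [b], the
   l-th sojourn overall is spent in state [b (+) odd l], and is the [l./2]-th
   one spent in that state. *)
Definition sojourn (S : bool -> nat -> R) (b : bool) (l : nat) : R :=
  S (b (+) odd l) l./2.

(* Instant at which the l-th sojourn starts. *)
Definition sojourn_start (S : bool -> nat -> R) (b : bool) (l : nat) : R :=
  \sum_(m < l) sojourn S b m.

Definition alternates (S : bool -> nat -> R) (x : R -> bool) :=
  forall (l : nat) (t : R), t \in `[0, T] ->
    sojourn_start S (x 0) l <= t < sojourn_start S (x 0) l.+1 ->
    x t = x 0 (+) odd l.

(* The sigma-algebras of the initial state ([None]) and of each single sojourn
   length. *)
Definition on_off_source (x : R -> Omega -> bool)
    (S : bool -> nat -> {RV P >-> R}) (o : option (bool * nat)) :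
    set (set Omega) :=
  if o is Some (b, k) then preimage_set_system setT (S b k) measurable
  else preimage_set_system setT (x 0) measurable.

(* [true] stands for the value 1 and [false] for the value 0. The process is
   indexed by R, but only its restriction to [0, T] is constrained. *)
Record on_off_process (x : R -> Omega -> bool) : Prop := OnOffProcess {
  on_off_measurable : forall t, t \in `[0, T] -> measurable [set w | x t w] ;
  on_off_cadlag : forall w, cadlag (fun t => (x t w)%:R) ;
  on_off_init : P [set w | x 0 w] = p0%:E ;
  on_off_sojourns : exists S : bool -> nat -> {RV P >-> R},
    [/\ forall b k (A : set R), measurable A ->
          distribution P (S b k) A = exponential_prob (if b then lon else loff) A,
        mutually_independent P (on_off_source x S) &
        {ae P, forall w, alternates (fun b k => S b k w) (x ^~ w)}] }.

Definition process_sigma_algebra (x : R -> Omega -> bool) : set (set Omega) :=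
  <<s [set [set w | x t w] | t in `[0, T]%classic] >>.

(* The dynamic Erdos-Renyi graph on N vertices. That the edge processes are
   identically distributed is part of the first condition, all parameters being
   the same for all edges. *)
Record dynamic_ER (N : nat) (a : 'I_N -> 'I_N -> R -> Omega -> bool) : Prop :=
  DynamicER {
  ER_on_off : forall i j : 'I_N, (i <= j)%N -> on_off_process (a i j) ;
  ER_sym : forall i j t w, t \in `[0, T] -> a i j t w = a j i t w ;
  ER_indep : mutually_independent P
    (fun e : {e : 'I_N * 'I_N | (e.1 <= e.2)%N} =>
       process_sigma_algebra (a (val e).1 (val e).2)) }.

Definition edge_prob (x : R -> Omega -> bool) (t : R) : R :=
  fine (P [set w | x t w]).

End OnOffProcess.

Definition adjacency {R : realType} {Omega : Type} (N : nat)
    (a : 'I_N -> 'I_N -> R -> Omega -> bool) (t : R) (w : Omega) : 'M[R]_N :=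
  \matrix_(i < N, j < N) (a i j t w)%:R.

(* For a symmetric A and 0 < N the spectrum is finite and nonempty, so that
   this supremum is a maximum. *)
Definition principal_eigenvalue {R : realType} (N : nat) (A : 'M[R]_N) : R :=
  sup [set x : R | eigenvalue A x].

(* Main.v *)
Require Import Defs.
From HB Require Import structures.
From mathcomp Require Import all_boot all_order all_algebra.
From mathcomp Require Import all_classical all_reals all_analysis.
From mathcomp Require Import measurable_realfun.
From mathcomp Require Import ring lra.

Import Order.TTheory GRing.Theory Num.Theory.
Import numFieldNormedType.Exports.

Local Open Scope classical_set_scope.
Local Open Scope ring_scope.

(** Write a snapshot of the graph as A = p J + H, where J is the all-ones matrix,
    p = p(t), and H is the symmetric matrix of the centred edges.  Put d = H 1,
    D = sum_i d_i, Q = sum_i d_i^2 and m = N p.  The vector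
    v = 1 + d / m + H d / m^2 is nearly an eigenvector of A for
    theta = m + D / N + Q / (N m): the entries of A v - theta v consist of
    H^3 1 / m^2 and of terms that are not larger, of order 1 / sqrt N up to
    logarithms.  For a symmetric nonnegative matrix such an entrywise estimate
    forces the principal eigenvalue to be close to theta
    ([principal_eigenvalue_approx]), so that the operator norm of H never
    enters.  Here D / N is the linear statistic of the theorem, while Q
    concentrates around N^2 p (1 - p).  Hence
    mu = N p + (1 - p) + D / N + O((log N)^3 / sqrt N)
    as soon as a few walk counts of H have their typical size ([regular],
    [principal_eigenvalue_expansion]).  Off that event the difference is still
    at most 5 N and D is centred, so the expectation of mu has the same
    expansion without D / N; the theorem is the difference of the two.

    At a fixed time the edges are independent Bernoulli variables, and every
    walk count has the form sum_e c_e h_e where the h_e are the centred edges,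
    revealed one after the other, and c_e depends only on edges revealed before
    e.  The Azuma-Hoeffding inequality [predictable_tail] bounds such sums.  For
    the walks that start at i, the row of i is revealed last; for Q, the
    coefficients are partial row sums.  This makes [regular] fail with
    probability at most 16 N^3 exp(- (log N)^2) ([prob_bad],
    [regular_noise]).

    To reach all times at once, [0, T] is cut into N^6 cells.  Outside an event
    of probability O(N^-2) the snapshots at the grid times are regular and at
    most one edge changes state inside each cell ([bad_event_le]); since
    [regular] survives the change of one edge ([regular_perturb]), the expansion
    holds at every time ([good_regular]), and the Borel-Cantelli lemma gives the
    almost sure bound.

    Two facts on a single edge are used: its law at time t does not depend on
    the edge, and it changes state in a time interval of length h with
    probability O(h) ([on_off_uniform]).  Both follow from the joint law of the
    initial state, the starting time of the l-th sojourn and the length of that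
    sojourn ([arrival_joint]), which is a product law because the sojourns are
    independent. *)

Set Implicit Arguments.
Unset Strict Implicit.
Unset Printing Implicit Defensive.

(** * Principal eigenvalue and approximate eigenvectors *)

Section PrincipalEigenvalue.
Variable R : realType.

Definition bil (n : nat) (M : 'M[R]_n) (x y : 'rV[R]_n) : R :=
  (x *m M *m y^T) 0 0.

Lemma bilE n (M : 'M[R]_n) x y :
  bil M x y = \sum_i \sum_j x 0 i * M i j * y 0 j.
Proof.
rewrite /bil mxE exchange_big /=; apply: eq_bigr => j _.
by rewrite !mxE big_distrl.
Qed.

Lemma bilC n (M : 'M[R]_n) x y : M^T = M -> bil M x y = bil M y x.
Proof.
move=> sM; rewrite /bil -[LHS]trace_mx11 -mxtrace_tr.
by rewrite !trmx_mul sM trmxK mulmxA trace_mx11.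
Qed.

Lemma bilDZ n (M : 'M[R]_n) x y s : M^T = M ->
  bil M (x + s *: y) (x + s *: y) =
    bil M x x + 2 * s * bil M x y + s ^+ 2 * bil M y y.
Proof.
move=> sM; have := bilC x y sM; rewrite /bil linearD /= linearZ /=.
rewrite !mulmxDl !mulmxDr -!scalemxAl -!scalemxAr => xy.
move: (x *m M *m x^T) (x *m M *m y^T) (y *m M *m x^T) (y *m M *m y^T) xy.
by move=> a b c e; rewrite !mxE => bc; rewrite bc; ring.
Qed.

Lemma dot_ge0 n (x : 'rV[R]_n) : 0 <= (x *m x^T) 0 0.
Proof. by rewrite mxE sumr_ge0// => i _; rewrite mxE -expr2 sqr_ge0. Qed.

Lemma dot_eq0 n (x : 'rV[R]_n) : (x *m x^T) 0 0 = 0 -> x = 0.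
Proof.
rewrite mxE => /eqP; rewrite psumr_eq0; last first.
  by move=> i _; rewrite mxE -expr2 sqr_ge0.
move=> /allP x0; apply/rowP => i; rewrite !mxE.
have := x0 i; rewrite mem_index_enum mxE -expr2 sqrf_eq0 => /(_ isT)/eqP.
by [].
Qed.

(** At a zero x of a nonnegative quadratic form, the form along the line
    x + s y has a minimum at s = 0, which kills its linear term. *)
Lemma psd_kernel n (M : 'M[R]_n) (x : 'rV[R]_n) : M^T = M ->
  (forall y, 0 <= bil M y y) -> bil M x x = 0 -> x *m M = 0.
Proof.
move=> sM M0 x0; apply: dot_eq0.
set y := x *m M.
have := M0 (x + (- bil M x y / (bil M y y + 1)) *: y).
rewrite bilDZ// x0 add0r.
set b := bil M x y; set c := bil M y y; have c0 : 0 <= c by exact: M0.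
have -> : (y *m y^T) 0 0 = b by [].
have [c1 c2] : 0 < c + 1 /\ 0 < c + 2 by split; clear sM; lra.
have -> : 2 * (- b / (c + 1)) * b + (- b / (c + 1)) ^+ 2 * c
   = - (b ^+ 2 * ((c + 2) / (c + 1) ^+ 2)) by clear sM; field; lra.
rewrite oppr_ge0 pmulr_lle0 ?divr_gt0 ?exprn_gt0//.
by move=> b0; apply/eqP; rewrite -sqrf_eq0 eq_le b0 sqr_ge0.
Qed.

Lemma continuous_bil n (M : 'M[R]_n) : continuous (fun x => bil M x x).
Proof.
under eq_fun do rewrite bilE.
apply: continuous_big => [|i _]; first exact: add_continuous.
apply: continuous_big => [|j _]; first exact: add_continuous.
move=> x; apply: (@cvgM R _ (nbhs x)); last exact: coord_continuous.
apply: (@cvgM R _ (nbhs x) _ (fun y : 'rV[R]_n => y 0 i) (fun=> M i j)).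
  exact: coord_continuous.
exact: cvg_cst.
Qed.

(** The Rayleigh quotient attains its maximum l on the compact unit sphere.
    Then l I - A is positive semidefinite and vanishes at the maximiser, which
    [psd_kernel] turns into an eigenvector. *)
Lemma rayleigh_eigenvalue n (A : 'M[R]_n) (v : 'rV[R]_n) : A^T = A -> v != 0 ->
  exists2 x, eigenvalue A x & bil A v v <= x * (v *m v^T) 0 0.
Proof.
move=> sA v0.
pose q (x : 'rV[R]_n) := bil 1%:M x x.
have qE x : q x = (x *m x^T) 0 0 by rewrite /q /bil mulmx1.
have qZ s x : q (s *: x) = s ^+ 2 * q x.
  by rewrite !qE linearZ /= -scalemxAl -scalemxAr !mxE mulrA.
have AZ s x : bil A (s *: x) (s *: x) = s ^+ 2 * bil A x x.
  by rewrite /bil linearZ /= -!scalemxAl -scalemxAr !mxE mulrA.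
have q_gt0 x : x != 0 -> 0 < q x.
  move=> x0; rewrite lt_neqAle qE dot_ge0 andbT eq_sym.
  by apply: contra_neq x0; exact: dot_eq0.
pose S := [set x | q x = 1].
have nrm x : x != 0 -> S ((Num.sqrt (q x))^-1 *: x).
  move=> x0; rewrite /S /= qZ exprVn sqr_sqrtr ?ltW ?q_gt0//.
  by rewrite mulVf// gt_eqF// q_gt0.
have cS : compact S.
  apply: bounded_closed_compact.
    exists 1; split => // r r1 x /= qx1; apply: le_trans (ltW r1).
    rewrite [leLHS]/Num.norm /= mx_normrE; apply/bigmax_leP; split => //= -[i j] _ /=.
    rewrite -(@expr_le1 _ 2)// -normrX ger0_norm ?sqr_ge0// -qx1 qE mxE.
    rewrite (bigD1 j)//= mxE -expr2 (ord1 i) lerDl sumr_ge0// => k _.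
    by rewrite mxE -expr2 sqr_ge0.
  have -> : S = q @^-1` [set 1] by [].
  apply: preimage_closed; [|exact: closed_eq].
  by move=> x _; exact: continuous_bil.
have [||x xS xmax] := @EVT_max_rV R n (fun x => bil A x x) S _ cS.
- by exists ((Num.sqrt (q v))^-1 *: v); exact: nrm.
- by apply: continuous_subspaceT => x; exact: continuous_bil.
have q1 : q x = 1 by move: xS; rewrite inE.
set l := bil A x x in xmax.
have lmax y : bil A y y <= l * q y.
  have [->|y0] := eqVneq y 0.
    by rewrite qE /bil !mul0mx !mxE mulr0.
  have := xmax _ (mem_set (nrm _ y0)).
  rewrite AZ exprVn sqr_sqrtr ?(ltW (q_gt0 _ y0))//.
  by rewrite ler_pdivrMl ?q_gt0// mulrC.
have ME y z : bil (l%:M - A) y z = l * (y *m z^T) 0 0 - bil A y z.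
  by rewrite /bil mulmxBr mulmxBl mul_mx_scalar -scalemxAl !mxE.
exists l; last by rewrite -qE.
apply/eigenvalueP; exists x; last first.
  by apply: contra_eq_neq q1 => ->; rewrite qE mul0mx mxE eq_sym oner_neq0.
have : x *m (l%:M - A) = 0.
  apply: psd_kernel.
  - by rewrite linearB /= tr_scalar_mx sA.
  - by move=> y; rewrite ME subr_ge0 -qE.
  - by rewrite ME -qE q1 mulr1 subrr.
by rewrite mulmxBr mul_mx_scalar => /eqP; rewrite subr_eq0 => /eqP.
Qed.

(** The upper bound is Collatz-Wielandt: look at an eigenvector u at the index
    where |u_i| / v_i is largest.  The lower bound is the Rayleigh quotient of
    v.  Both lose at most 2 e because v is bounded below by 1/2. *)
Lemma principal_eigenvalue_approx n (A : 'M[R]_n) (v : 'I_n -> R) (th e : R) :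
  (0 < n)%N -> A^T = A -> (forall i j, 0 <= A i j) ->
  (forall i, 2^-1 <= v i) ->
  (forall i, `|\sum_j A i j * v j - th * v i| <= e) ->
  `|principal_eigenvalue A - th| <= 2 * e.
Proof.
move=> n0 sA A0 v12 vth.
have v0 i : 0 < v i by apply: lt_le_trans (v12 i); lra.
have e0 : 0 <= e by apply: le_trans (vth (Ordinal n0)).
have symA i j : A i j = A j i by rewrite -[in LHS]sA mxE.
have ub x : eigenvalue A x -> x <= th + 2 * e.
  case/eigenvalueP => u uA u0.
  pose g i := `|u 0 i| / v i.
  pose i := [arg max_(i > Ordinal n0) g i]%O.
  have gi j : g j <= g i by rewrite /i; case: arg_maxP => // i0 _; exact.
  have ui j : `|u 0 j| <= g i * v j by rewrite -ler_pdivrMr// gi.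
  have g0 : 0 < g i.
    have g_ge0 : 0 <= g i by rewrite divr_ge0// ltW.
    rewrite lt_neqAle g_ge0 andbT eq_sym.
    apply: contra_neq u0 => gi0; apply/rowP => j; rewrite mxE; apply/eqP.
    by rewrite -normr_le0; apply: le_trans (ui j) _; rewrite gi0 mul0r.
  have uiE : `|u 0 i| = g i * v i by rewrite /g divfK// gt_eqF.
  have : x * `|u 0 i| <= g i * ((th + 2 * e) * v i).
    apply: (@le_trans _ _ (`|x| * `|u 0 i|)); first by rewrite ler_wpM2r// ler_norm.
    rewrite -normrM.
    have -> : x * u 0 i = \sum_j u 0 j * A j i.
      by move/rowP : uA => /(_ i); rewrite !mxE => <-.
    apply: le_trans (ler_norm_sum _ _ _) _.
    apply: (@le_trans _ _ (\sum_j g i * (A i j * v j))).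
      apply: ler_sum => j _; rewrite normrM (ger0_norm (A0 _ _)) symA.
      by rewrite mulrCA mulrC ler_wpM2l// ui.
    rewrite -mulr_sumr ler_pM2l//.
    have := vth i; rewrite ler_norml => /andP[_].
    rewrite lerBlDr => /le_trans; apply; rewrite mulrDl addrC lerD2l.
    by have := ler_wpM2l e0 (v12 i); lra.
  by rewrite uiE mulrCA ler_pM2l// ler_pM2r.
pose V : 'rV[R]_n := \row_i v i.
have V0 : V != 0.
  by apply/eqP => /rowP/(_ (Ordinal n0)); rewrite !mxE; have := v0 (Ordinal n0); lra.
have [x xA xV] := rayleigh_eigenvalue sA V0.
have hsup : has_sup [set x : R | eigenvalue A x].
  by split; [exists x|exists (th + 2 * e)].
rewrite ler_norml; apply/andP; split; last first.
  by rewrite lerBlDl; apply: ge_sup => //; exists x.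
rewrite lerBrDr addrC; apply: le_trans (sup_upper_bound hsup xA).
have VV : (V *m V^T) 0 0 = \sum_i v i ^+ 2.
  by rewrite mxE; apply: eq_bigr => i _; rewrite !mxE expr2.
have VV0 : 0 < (V *m V^T) 0 0.
  rewrite lt_neqAle dot_ge0 andbT eq_sym.
  by apply: contra_neq V0; exact: dot_eq0.
rewrite -(ler_pM2r VV0); apply: le_trans xV.
rewrite VV mulr_sumr bilE; apply: ler_sum => i _.
under eq_bigr do rewrite !mxE -mulrA; rewrite -mulr_sumr.
have := vth i; rewrite ler_norml => /andP[+ _]; rewrite lerBrDr => h.
apply: le_trans (ler_wpM2l (ltW (v0 i)) h).
rewrite (_ : (th - 2 * e) * v i ^+ 2 = v i * ((th - 2 * e) * v i)); last first.
  by rewrite expr2 mulrCA.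
apply: ler_wpM2l; first exact: ltW.
by have := ler_wpM2l e0 (v12 i); move: (v i) => w; rewrite mulrBl; lra.
Qed.

End PrincipalEigenvalue.

(** * Walk counts and their stability *)

Section Expansion.
Variables (R : realType) (n : nat).
Implicit Types (H B : 'I_n -> 'I_n -> R) (x : 'I_n -> R).

Definition mulfv H x : 'I_n -> R := fun i => \sum_j H i j * x j.

(** [walks H k i] is the i-th entry of H^k 1, the weight of the walks of length
    k that start at i. *)
Definition walks H k : 'I_n -> R := iter k (mulfv H) (fun=> 1).
Arguments walks : simpl never.

(** With s = sqrt n and l a logarithm: the walk counts of length at most 3, their
    total and the sum of the squared row sums have the size that they typically
    have for independent centred entries of variance p (1 - p). *)
Record regular H (p s l K : R) : Prop := Regular {
  regular1 : forall i, `|walks H 1 i| <= K * (s * l) ;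
  regular2 : forall i, `|walks H 2 i| <= K * (s ^+ 2 * l ^+ 2) ;
  regular3 : forall i, `|walks H 3 i| <= K * (s ^+ 3 * l ^+ 3) ;
  regular_sum : `|\sum_i walks H 1 i| <= K * (s ^+ 2 * l) ;
  regular_sqr : `|\sum_i walks H 1 i ^+ 2 - s ^+ 4 * (p * (1 - p))|
                  <= K * (s ^+ 3 * l ^+ 2) }.

Lemma walksS H k : walks H k.+1 = mulfv H (walks H k).
Proof. by []. Qed.

Lemma walks1 H i : walks H 1 i = \sum_j H i j.
Proof. by apply: eq_bigr => j _; rewrite mulr1. Qed.

Lemma sum_walks2 H : (forall i j, H i j = H j i) ->
  \sum_i walks H 2 i = \sum_i walks H 1 i ^+ 2.
Proof.
move=> sH; rewrite exchange_big /=; apply: eq_bigr => j _.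
rewrite -mulr_suml expr2; congr (_ * _).
by apply/esym; rewrite [LHS]walks1; apply: eq_bigr => i _; rewrite sH.
Qed.

Lemma ler_normM (a b c d : R) : `|a| <= c -> `|b| <= d -> `|a * b| <= c * d.
Proof. by move=> ac bd; rewrite normrM ler_pM. Qed.

Lemma mulfv_bound H x b : (forall i j, `|H i j| <= 1) ->
  (forall j, `|x j| <= b) -> forall i, `|mulfv H x i| <= n%:R * b.
Proof.
move=> H1 xb i; apply: le_trans (ler_norm_sum _ _ _) _.
rewrite mulr_natl -[leRHS](_ : \sum_(j < n) b = _); last first.
  by rewrite sumr_const card_ord.
by apply: ler_sum => j _; rewrite -[b]mul1r; exact: ler_normM.
Qed.

Lemma mulfv_bound_l H x b c i : \sum_j `|H i j| <= c ->
  (forall j, `|x j| <= b) -> `|mulfv H x i| <= c * b.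
Proof.
move=> Hc xb; apply: le_trans (ler_norm_sum _ _ _) _.
apply: (@le_trans _ _ ((\sum_j `|H i j|) * b)).
  by rewrite mulr_suml; apply: ler_sum => j _; exact: ler_normM.
by apply: ler_wpM2r => //; exact: le_trans (xb i).
Qed.

Lemma mulfv_bound_r H x b : (forall i j, `|H i j| <= 1) ->
  \sum_j `|x j| <= b -> forall i, `|mulfv H x i| <= b.
Proof.
move=> H1 xb i; apply: le_trans (ler_norm_sum _ _ _) (le_trans _ xb).
by apply: ler_sum => j _; rewrite -[leRHS]mul1r; exact: ler_normM.
Qed.

(** The bound 3 covers an edge whose state changes (two entries, or one for a
    loop) and a total change of at most 1 caused by p.  Each walk count of the
    perturbed matrix is the old one plus walks with a step in B; such a step
    costs only 3 instead of a factor s l, so crude bounds suffice. *)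
Lemma regular_perturb H B p p' s l K : 1 <= l -> 1 <= s -> 0 <= K ->
  s ^+ 2 = n%:R ->
  0 <= p <= 1 -> 0 <= p' <= 1 -> `|p' - p| <= (s ^+ 2)^-1 ->
  (forall i j, `|H i j + B i j| <= 1) ->
  \sum_i \sum_j `|B i j| <= 3 ->
  regular H p s l K ->
  regular (fun i j => H i j + B i j) p' s l (7 * K + 10).
Proof.
move=> l1 s1 K0 sn p01 p'01 pp H'1 B3 [r1 r2 r3 rs rq].
set H' := fun i j => _.
have sl1 : 1 <= s * l by rewrite mulr_ege1.
pose b i := \sum_j B i j.
have b3 : \sum_i `|b i| <= 3.
  by apply: le_trans B3; apply: ler_sum => i _; exact: ler_norm_sum.
have bi i : `|b i| <= 3.
  by apply: le_trans b3; rewrite (bigD1 i)//= lerDl sumr_ge0.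
have Bi i : \sum_j `|B i j| <= 3.
  apply: le_trans B3; rewrite [leRHS](bigD1 i)//= lerDl.
  by apply: sumr_ge0 => k _; apply: sumr_ge0.
have d1 i : walks H' 1 i = walks H 1 i + b i by rewrite !walks1 -big_split.
have split2 x y i : (forall j, y j = x j + (y j - x j)) ->
    mulfv H' y i = mulfv H x i + (mulfv B x i + mulfv H' (fun j => y j - x j) i).
  move=> xy; rewrite -!big_split; apply: eq_bigr => j _ /=.
  by rewrite /H'; ring.
have w2 i : `|walks H' 2 i - walks H 2 i| <= (3 * K + 3) * (s * l).
  rewrite !(walksS _ 1) (split2 (walks H 1)); last by move=> j; ring.
  rewrite addrAC subrr add0r mulrDl; apply: le_trans (ler_normD _ _) _.
  apply: lerD; first by rewrite -mulrA; exact: mulfv_bound_l.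
  apply: (@le_trans _ _ 3); last by lra.
  apply: mulfv_bound_r => //; apply: le_trans b3; apply: ler_sum => j _.
  by rewrite d1 addrAC subrr add0r.
have s2 : 1 <= s ^+ 2 by rewrite exprn_ege1.
have s3 : 1 <= s ^+ 3 by rewrite exprn_ege1.
have l2 : 1 <= l ^+ 2 by rewrite exprn_ege1.
have sl2 : s * l <= s ^+ 2 * l ^+ 2 by rewrite -exprMn expr2 ler_peMr//; lra.
have sl2l : s * l <= s ^+ 2 * l.
  by rewrite ler_wpM2r ?expr2 ?ler_peMr//; lra.
have sl3 : s ^+ 2 * l ^+ 2 <= s ^+ 3 * l ^+ 2.
  by rewrite ler_wpM2r ?(exprS _ 2) ?ler_peMl//; lra.
have sl4 : s ^+ 3 * l <= s ^+ 3 * l ^+ 2.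
  by rewrite ler_wpM2l// ?expr2 ?ler_peMr//; lra.
have sl5 : s ^+ 3 * l ^+ 2 <= s ^+ 3 * l ^+ 3.
  by rewrite ler_wpM2l// ?(exprS _ 2) ?ler_peMl//; lra.
have s31 : s ^+ 3 <= s ^+ 3 * l by rewrite ler_peMr//; lra.
have Kle a c : 0 <= a -> a <= c -> K * a <= K * c by move=> _; exact: ler_wpM2l.
split=> [i|i|i||].
- rewrite d1; apply: le_trans (ler_normD _ _) _.
  have := r1 i; have := bi i; have : 0 <= K * (s * l) by nra.
  by lra.
- rewrite -[walks H' 2 i](subrK (walks H 2 i)).
  apply: le_trans (ler_normD _ _) _.
  have := w2 i; have := r2 i; have := Kle _ _ _ sl2; nra.
- rewrite (walksS _ 2) (split2 (walks H 2)); last by move=> j; ring.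
  apply: le_trans (ler_normD _ _) _.
  have h3 := r3 i; rewrite (walksS _ 2) in h3.
  have h4 : `|mulfv B (walks H 2) i| <= 3 * (K * (s ^+ 2 * l ^+ 2)).
    exact: mulfv_bound_l.
  have h5 : `|mulfv H' (fun j => walks H' 2 j - walks H 2 j) i| <=
     s ^+ 2 * ((3 * K + 3) * (s * l)).
    by rewrite sn; exact: mulfv_bound.
  have h6 := ler_normD (mulfv B (walks H 2) i)
    (mulfv H' (fun j => walks H' 2 j - walks H 2 j) i).
  have e5 : s ^+ 2 * ((3 * K + 3) * (s * l)) = (3 * K + 3) * (s ^+ 3 * l) by ring.
  rewrite e5 in h5.
  have k1 : K * (s ^+ 2 * l ^+ 2) <= K * (s ^+ 3 * l ^+ 3).
    by apply: ler_wpM2l => //; apply: le_trans sl5.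
  have k2 : K * (s ^+ 3 * l) <= K * (s ^+ 3 * l ^+ 3).
    by apply: ler_wpM2l => //; apply: le_trans sl5.
  lra.
- rewrite (eq_bigr (fun i => walks H 1 i + b i)) => [|i _]; last exact: d1.
  rewrite big_split /=; apply: le_trans (ler_normD _ _) _.
  have := le_trans (ler_norm_sum _ _ _) b3.
  have : 0 <= K * (s ^+ 2 * l) by rewrite mulr_ge0//; lra.
  by lra.
- have -> : \sum_i walks H' 1 i ^+ 2 - s ^+ 4 * (p' * (1 - p')) =
     (\sum_i walks H 1 i ^+ 2 - s ^+ 4 * (p * (1 - p)))
     + (\sum_i b i * (2 * walks H 1 i + b i) - s ^+ 4 * ((p' - p) * (1 - p' - p))).
    have -> : \sum_i walks H' 1 i ^+ 2 =
       \sum_i walks H 1 i ^+ 2 + \sum_i b i * (2 * walks H 1 i + b i).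
      by rewrite -big_split; apply: eq_bigr => i _ /=; rewrite d1; ring.
    by ring.
  have e1 : `|\sum_i b i * (2 * walks H 1 i + b i)| <= 3 * (2 * (K * (s * l)) + 3).
    apply: le_trans (ler_norm_sum _ _ _) _.
    apply: (@le_trans _ _ (\sum_i `|b i| * (2 * (K * (s * l)) + 3))).
      apply: ler_sum => i _; rewrite normrM ler_wpM2l//.
      apply: le_trans (ler_normD _ _) _; apply: lerD => //.
      by rewrite normrM ger0_norm// ler_wpM2l.
    by rewrite -mulr_suml ler_wpM2r//; nra.
  have e2 : `|s ^+ 4 * ((p' - p) * (1 - p' - p))| <= s ^+ 2.
    have -> : s ^+ 4 * ((p' - p) * (1 - p' - p)) =
      s ^+ 4 * (p' - p) * (1 - p' - p) by ring.
    rewrite -[s ^+ 2]mulr1; apply: ler_normM; last by rewrite ler_norml; lra.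
    have -> : s ^+ 2 = s ^+ 4 * (s ^+ 2)^-1 by field; lra.
    by apply: ler_normM => //; rewrite ger0_norm// exprn_ge0//; lra.
  have h1 := ler_normD (\sum_i walks H 1 i ^+ 2 - s ^+ 4 * (p * (1 - p)))
    (\sum_i b i * (2 * walks H 1 i + b i) - s ^+ 4 * ((p' - p) * (1 - p' - p))).
  have h2 := ler_normB (\sum_i b i * (2 * walks H 1 i + b i))
                (s ^+ 4 * ((p' - p) * (1 - p' - p))).
  have k1 : K * (s * l) <= K * (s ^+ 3 * l ^+ 2).
    by apply: ler_wpM2l => //; exact: le_trans sl3.
  have s23 : s ^+ 2 <= s ^+ 3 * l ^+ 2.
    by apply: le_trans sl3; rewrite ler_peMr//; lra.
  by lra.
Qed.

End Expansion.
Arguments walks : simpl never.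

(** * Walk counts from the deviations of single rows *)

Section Rows.
Variables (R : realType) (n : nat).
Implicit Types (H B : 'I_n -> 'I_n -> R) (x : 'I_n -> R).

(** Rows and columns are erased rather than deleted, so that the matrix keeps its
    size; what remains does not depend on row i. *)
Definition isolate H (i : 'I_n) (j k : 'I_n) : R :=
  if (j == i) || (k == i) then 0 else H j k.

Lemma isolate_out H i k : isolate H i i k = 0.
Proof. by rewrite /isolate eqxx. Qed.

Lemma walks_isolate_out H i k : walks (isolate H i) k.+1 i = 0.
Proof. by rewrite walksS /mulfv big1// => j _; rewrite isolate_out mul0r. Qed.

Lemma mulfv_isolate H i j x : j != i ->
  mulfv (isolate H i) x j = \sum_(k | k != i) H j k * x k.
Proof.
move=> ji; rewrite /mulfv (bigD1 i)//= /isolate eqxx orbT mul0r add0r.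
by apply: eq_bigr => k /negPf ki; rewrite (negPf ji) ki.
Qed.

(** In each field the coefficients of row i come from [isolate H i] or are
    constant, so for a random H they are independent of that row.  The last two
    fields are conditional: their premise follows from the preceding ones. *)
Record row_bounded H (s l : R) : Prop := RowBounded {
  row_bounded1 : forall i, `|walks H 1 i| <= 3 * (s * l) ;
  row_bounded2 : forall i j, j != i ->
    `|\sum_k H i k * isolate H i j k| <= 3 * (s * l) ;
  row_bounded3 : (forall i j, `|walks (isolate H i) 1 j| <= 4 * (s * l)) ->
    forall i, `|\sum_j H i j * walks (isolate H i) 1 j| <= 12 * (s ^+ 2 * l ^+ 2) ;
  row_bounded4 : (forall i j, `|walks (isolate H i) 2 j| <= 22 * (s ^+ 2 * l ^+ 2)) ->
    forall i, `|\sum_j H i j * walks (isolate H i) 2 j| <= 66 * (s ^+ 3 * l ^+ 3) }.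

(** A walk from i is decomposed at its returns to i: the part that never returns
    is a field of [row_bounded], and the walks that do return are counted by
    shorter walks, with one free step fewer. *)
Lemma row_bounded_walks H s l : (forall i j, H i j = H j i) ->
  (forall i j, `|H i j| <= 1) -> 1 <= s -> 1 <= l -> s ^+ 2 = n%:R ->
  row_bounded H s l ->
  [/\ forall i, `|walks H 1 i| <= 88 * (s * l),
      forall i, `|walks H 2 i| <= 88 * (s ^+ 2 * l ^+ 2) &
      forall i, `|walks H 3 i| <= 88 * (s ^+ 3 * l ^+ 3)].
Proof.
move=> sH H1 s1 l1 sn [g1 g2 g3 g4].
have o1 : 1 <= s * l by rewrite mulr_ege1.
have s2 : 1 <= s ^+ 2 by rewrite exprn_ege1.
have s3 : 1 <= s ^+ 3 by rewrite exprn_ege1.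
have l2 : 1 <= l ^+ 2 by rewrite exprn_ege1.
have o2 : s * l <= s ^+ 2 * l ^+ 2 by rewrite -exprMn expr2 ler_peMr//; lra.
have o2' : s ^+ 2 <= s ^+ 2 * l ^+ 2 by rewrite ler_peMr//; lra.
have o3 : s ^+ 2 * l ^+ 2 <= s ^+ 3 * l ^+ 3.
  by rewrite -!exprMn [leRHS]exprS ler_peMl//; apply: exprn_ge0; lra.
have o3' : s ^+ 3 * l <= s ^+ 3 * l ^+ 3.
  by rewrite ler_wpM2l//; [lra|rewrite exprS ler_peMr//; lra].
have e1 i j : j != i -> walks H 1 j = H j i + walks (isolate H i) 1 j.
  move=> ji; rewrite (walksS (isolate _ _)) mulfv_isolate//.
  rewrite (walksS H) {1}/mulfv (bigD1 i)//= mulr1; congr (_ + _).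
(* premise of [row_bounded3] *)
have m1 i j : `|walks (isolate H i) 1 j| <= 4 * (s * l).
  have [->|ji] := eqVneq j i; first by rewrite walks_isolate_out normr0; lra.
  have -> : walks (isolate H i) 1 j = walks H 1 j - H j i by rewrite (e1 i)//; ring.
  by apply: le_trans (ler_normB _ _) _; have := g1 j; have := H1 j i; lra.
have w2 i : `|walks H 2 i| <= 16 * (s ^+ 2 * l ^+ 2).
  pose u j := if j == i then walks H 1 i else H i j.
  have -> : walks H 2 i = \sum_j H i j * u j + \sum_j H i j * walks (isolate H i) 1 j.
    rewrite (walksS H 1) {1}/mulfv -big_split; apply: eq_bigr => j _ /=.
    rewrite /u; have [->|ji] := eqVneq j i; first by rewrite walks_isolate_out; ring.
    by rewrite (e1 i)// (sH j i); ring.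
  apply: le_trans (ler_normD _ _) _; have := g3 m1 i.
  have : `|\sum_j H i j * u j| <= s ^+ 2 + 3 * (s * l).
    rewrite (bigD1 i)//= addrC; apply: le_trans (ler_normD _ _) _; apply: lerD.
      rewrite sn; apply: le_trans (ler_norm_sum _ _ _) _.
      apply: (@le_trans _ _ (\sum_(j < n) 1)); last first.
        by rewrite sumr_const card_ord.
      rewrite [leRHS](bigD1 i)//= -[leLHS]add0r; apply: lerD => //.
      apply: ler_sum => j /negPf ji; rewrite /u ji -[leRHS]mul1r.
      exact: ler_normM.
    rewrite /u eqxx -[leRHS]mul1r; exact: ler_normM.
  by lra.
have e2 i j : j != i -> walks H 2 j = H j i * walks H 1 i
    + \sum_k H i k * isolate H i j k + walks (isolate H i) 2 j.
  move=> ji; rewrite (walksS H) {1}/mulfv (bigD1 i)//= -addrA; congr (_ + _).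
  rewrite (walksS (isolate _ _) 1) mulfv_isolate//.
  rewrite [X in _ = X + _](bigD1 i)//= {1}/isolate eqxx orbT mulr0 add0r.
  rewrite -big_split; apply: eq_bigr => k ki /=.
  rewrite (e1 i k)// /isolate (negPf ji) (negPf ki) /= (sH k i); ring.
(* premise of [row_bounded4] *)
have m2 i j : `|walks (isolate H i) 2 j| <= 22 * (s ^+ 2 * l ^+ 2).
  have [->|ji] := eqVneq j i; first by rewrite walks_isolate_out normr0; lra.
  have -> : walks (isolate H i) 2 j = walks H 2 j
     - (H j i * walks H 1 i + \sum_k H i k * isolate H i j k).
    by rewrite (e2 i j)//; ring.
  apply: le_trans (ler_normB _ _) _.
  have h1 := ler_normD (H j i * walks H 1 i) (\sum_k H i k * isolate H i j k).
  have h2 : `|H j i * walks H 1 i| <= 1 * (3 * (s * l)) by exact: ler_normM.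
  have h3 := g2 _ _ ji; have := w2 j; lra.
split=> i.
- by apply: le_trans (g1 i) _; lra.
- by apply: le_trans (w2 i) _; lra.
pose u j := if j == i then walks H 2 i else
  H j i * walks H 1 i + \sum_k H i k * isolate H i j k.
have -> : walks H 3 i = \sum_j H i j * u j + \sum_j H i j * walks (isolate H i) 2 j.
  rewrite (walksS H 2) {1}/mulfv -big_split; apply: eq_bigr => j _ /=.
  rewrite /u; have [->|ji] := eqVneq j i; first by rewrite walks_isolate_out; ring.
  by rewrite (e2 i)//; ring.
apply: le_trans (ler_normD _ _) _; have := g4 m2 i.
have : `|\sum_j H i j * u j| <= s ^+ 2 * (6 * (s * l)) + 16 * (s ^+ 2 * l ^+ 2).
  rewrite (bigD1 i)//= addrC; apply: le_trans (ler_normD _ _) _; apply: lerD.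
    apply: le_trans (ler_norm_sum _ _ _) _.
    apply: (@le_trans _ _ (\sum_(j < n) (6 * (s * l)))); last first.
      by rewrite sumr_const card_ord sn -[leLHS]mulr_natl.
    rewrite [leRHS](bigD1 i)//= -[leLHS]add0r; apply: lerD; first lra.
    apply: ler_sum => j ji; rewrite /u (negPf ji) -[leRHS]mul1r.
    apply: ler_normM => //; apply: le_trans (ler_normD _ _) _.
    have h2 : `|H j i * walks H 1 i| <= 1 * (3 * (s * l)) by exact: ler_normM.
    have h3 := g2 _ _ ji; lra.
  rewrite /u eqxx -[leRHS]mul1r; exact: ler_normM.
have -> : s ^+ 2 * (6 * (s * l)) = 6 * (s ^+ 3 * l) by ring.
by lra.
Qed.

End Rows.

(** [principal_eigenvalue_approx] for the test vector
    1 + H 1 / m + H^2 1 / m^2 with m = s^2 p.  Its image under p J + H has a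
    constant part, which defines theta, and the remaining defect is
    H^3 1 / m^2 - (theta - m) (H 1 / m + H^2 1 / m^2), whose entries are of
    order l^3 / s. *)
Lemma principal_eigenvalue_expansion (R : realType) n (H : 'I_n -> 'I_n -> R)
    p s l K c (A : 'M[R]_n) :
  (0 < n)%N -> (forall i j, H i j = H j i) ->
  (forall i j, A i j = p + H i j) -> (forall i j, 0 <= A i j) ->
  0 < s -> s ^+ 2 = n%:R -> 1 <= l -> 1 <= K -> 0 < c -> c <= 1 -> c <= p ->
  8 * K * l <= c * s ->
  regular H p s l K ->
  `|principal_eigenvalue A - (s ^+ 2 * p + (1 - p) +
      (\sum_i walks H 1 i) / s ^+ 2)| <= (15 * K ^+ 2 / c ^+ 2) * (l ^+ 3 / s).
Proof.
move=> n0 sH AE A0 s0 sn l1 K1 c0 c1 cp small [r1 r2 r3 rs rq].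
set D := \sum_i _.
pose Q := \sum_i walks H 1 i ^+ 2.
rewrite -/Q in rq; rewrite -/D in rs.
pose m := s ^+ 2 * p.
have p0 : 0 < p by lra.
have cN : c != 0 by rewrite gt_eqF.
have sN : s != 0 by rewrite gt_eqF.
have pN : p != 0 by rewrite gt_eqF.
have l0 : 0 < l by lra.
have K0 : 0 <= K by lra.
have m0 : 0 < m by rewrite mulr_gt0// exprn_gt0.
pose r := l / (c * s).
have cs0 : 0 < c * s by rewrite mulr_gt0.
have r0 : 0 < r by rewrite divr_gt0//; lra.
have Kr : K * r <= 8^-1.
  by rewrite /r mulrA ler_pdivrMr//; lra.
have rK : r <= 8^-1 by apply: le_trans Kr; rewrite ler_peMl//; lra.
have csm : c * s * s <= m by rewrite /m; nra.
have b1 i : `|walks H 1 i / m| <= K * r.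
  rewrite normrM normfV (gtr0_norm m0) ler_pdivrMr//.
  apply: le_trans (r1 i) _; rewrite -mulrA ler_pM2l; last lra.
  apply: le_trans (_ : r * (c * s * s) <= _); last by rewrite ler_pM2l.
  by rewrite /r (_ : _ * (c * s * s) = s * l)//; field; rewrite ?cN ?sN ?pN.
have b2 i : `|walks H 2 i / m ^+ 2| <= K * r * r.
  rewrite normrM normfV (gtr0_norm (exprn_gt0 2 m0)) ler_pdivrMr ?exprn_gt0//.
  apply: le_trans (r2 i) _.
  rewrite (_ : K * r * r * m ^+ 2 = K * (r * (r * m ^+ 2))); last by rewrite -!mulrA.
  apply: ler_wpM2l => //.
  apply: le_trans (_ : r * (r * (c * s * s) ^+ 2) <= _); last first.
    apply: ler_wpM2l; first exact: ltW.
    apply: ler_wpM2l; first exact: ltW.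
    by apply: lerXn2r; rewrite ?nnegrE//; [rewrite !mulr_ge0 ?ltW|exact: ltW].
  by rewrite /r (_ : _ * (_ * (c * s * s) ^+ 2) = s ^+ 2 * l ^+ 2)//; field; rewrite ?cN ?sN ?pN.
have b3 i : `|walks H 3 i / m ^+ 2| <= K / c ^+ 2 * (l ^+ 3 / s).
  rewrite normrM normfV (gtr0_norm (exprn_gt0 2 m0)) ler_pdivrMr ?exprn_gt0//.
  apply: le_trans (r3 i) _.
  rewrite (_ : K / c ^+ 2 * (l ^+ 3 / s) * m ^+ 2 =
    K * ((c ^+ 2)^-1 * (l ^+ 3 * (s^-1 * m ^+ 2)))); last by rewrite -!mulrA.
  apply: ler_wpM2l => //.
  apply: le_trans (_ : (c ^+ 2)^-1 * (l ^+ 3 * (s^-1 * (c * s * s) ^+ 2)) <= _).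
    by rewrite (_ : (c ^+ 2)^-1 * _ = s ^+ 3 * l ^+ 3)//; field; rewrite ?cN ?sN ?pN.
  apply: ler_wpM2l; first by rewrite invr_ge0 exprn_ge0//; lra.
  apply: ler_wpM2l; first by apply: exprn_ge0; exact: ltW.
  apply: ler_wpM2l; first by rewrite invr_ge0; lra.
  by apply: lerXn2r; rewrite ?nnegrE//; [rewrite !mulr_ge0 ?ltW|exact: ltW].
pose th := m + D / s ^+ 2 + Q / (s ^+ 2 * m).
pose v i := 1 + walks H 1 i / m + walks H 2 i / m ^+ 2.
have KrKr : K * r * r <= 8^-1 by apply: le_trans Kr; rewrite ler_piMr//; nra.
have v12 i : 2^-1 <= v i.
  have := b1 i; have := b2 i; rewrite /v !ler_norml => /andP[? _] /andP[? _].
  lra.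
have s4 : 0 < s ^+ 4 by rewrite exprn_gt0.
have lls : l ^+ 2 / (c * s) <= l ^+ 3 / (c * s).
  rewrite ler_pM2r ?invr_gt0// [leRHS]exprS ler_peMl//; apply: exprn_ge0; exact: ltW.
have bQ : `|Q / (s ^+ 4 * p) - (1 - p)| <= K * (l ^+ 2 / (c * s)).
  have -> : Q / (s ^+ 4 * p) - (1 - p) =
     (Q - s ^+ 4 * (p * (1 - p))) / (s ^+ 4 * p) by field; rewrite ?cN ?sN ?pN.
  have sp0 : 0 < s ^+ 4 * p by rewrite mulr_gt0.
  rewrite normrM normfV (gtr0_norm sp0) ler_pdivrMr//.
  apply: le_trans rq _; rewrite -[leRHS]mulrA; apply: ler_wpM2l => //.
  apply: le_trans (_ : l ^+ 2 / (c * s) * (s ^+ 4 * c) <= _); last first.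
    rewrite ler_pM2l; last by rewrite divr_gt0// exprn_gt0//; lra.
    by rewrite ler_pM2l.
  by rewrite (_ : _ * (s ^+ 4 * c) = s ^+ 3 * l ^+ 2)//; field; rewrite ?cN ?sN ?pN.
have thE : th = s ^+ 2 * p + D / s ^+ 2 + Q / (s ^+ 4 * p).
  by rewrite /th /m; field; rewrite ?cN ?sN ?pN.
have bD : `|D / s ^+ 2| <= K * l.
  rewrite normrM normfV (gtr0_norm (exprn_gt0 2 s0)) ler_pdivrMr ?exprn_gt0//.
  by apply: le_trans rs _; rewrite -[leRHS]mulrA (mulrC l).
have Avth i : `|\sum_j A i j * v j - th * v i| <=
    (K / c ^+ 2 + 2 * K * (K + 2) / c) * (l ^+ 3 / s).
  have sumv : \sum_j v j = s ^+ 2 + D / m + Q / m ^+ 2.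
    rewrite /v !big_split /= -!mulr_suml sumr_const card_ord sn.
    by rewrite (sum_walks2 sH).
  have -> : \sum_j A i j * v j = p * (\sum_j v j) + (walks H 1 i
      + walks H 2 i / m + walks H 3 i / m ^+ 2).
    rewrite mulr_sumr [walks H 1 i]walks1 (walksS H 1) (walksS H 2) /mulfv.
    rewrite !mulr_suml -!big_split /=.
    by apply: eq_bigr => j _; rewrite AE /v; ring.
  have -> : p * (\sum_j v j) + (walks H 1 i + walks H 2 i / m + walks H 3 i / m ^+ 2)
     - th * v i = walks H 3 i / m ^+ 2 -
      (D / s ^+ 2 + Q / (s ^+ 4 * p)) * (walks H 1 i / m + walks H 2 i / m ^+ 2).
    by rewrite sumv /th /v /m; field; rewrite ?cN ?sN ?pN.
  apply: le_trans (ler_normB _ _) _; rewrite [leRHS]mulrDl; apply: lerD; first exact: b3.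
  apply: (@le_trans _ _ (((K + 2) * l) * (K * r + K * r))).
    apply: ler_normM; last first.
      apply: le_trans (ler_normD _ _) _; apply: lerD; first exact: b1.
      by apply: le_trans (b2 i) _; rewrite ler_piMr//; nra.
    apply: le_trans (ler_normD _ _) _; rewrite [leRHS]mulrDl; apply: lerD => //.
    have := bQ; have -> : K * (l ^+ 2 / (c * s)) = K * r * l by rewrite /r; field; rewrite ?cN ?sN ?pN.
    rewrite !ler_norml => /andP[h1 h2].
    have : K * r * l <= 8^-1 * l by rewrite ler_wpM2r//; lra.
    have : 0 <= Q / (s ^+ 4 * p).
      rewrite divr_ge0//; last by rewrite mulr_ge0// ltW.
      by apply: sumr_ge0 => j _; exact: sqr_ge0.
    by lra.
  rewrite (_ : (K + 2) * l * (K * r + K * r) =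
     2 * K * (K + 2) / c * (l ^+ 2 / s)); last by rewrite /r; field; rewrite ?cN ?sN ?pN.
  apply: ler_wpM2l.
    by apply: divr_ge0; [rewrite !mulr_ge0// addr_ge0|exact: ltW].
  rewrite ler_pM2r ?invr_gt0// [leRHS]exprS ler_peMl//; apply: exprn_ge0; exact: ltW.
have sA : A^T = A by apply/matrixP => i j; rewrite mxE !AE sH.
have := principal_eigenvalue_approx n0 sA A0 v12 Avth.
rewrite thE => h.
have h2 : principal_eigenvalue A - (s ^+ 2 * p + (1 - p) + D / s ^+ 2) =
  (principal_eigenvalue A - (s ^+ 2 * p + D / s ^+ 2 + Q / (s ^+ 4 * p)))
  + (Q / (s ^+ 4 * p) - (1 - p)) by ring.
rewrite h2; apply: le_trans (ler_normD _ _) _.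
apply: le_trans (lerD h bQ) _.
have h3 : K * (l ^+ 2 / (c * s)) <= K / c * (l ^+ 3 / s).
  rewrite -[leRHS]mulrA; apply: ler_wpM2l => //.
  by apply: le_trans lls _; rewrite (_ : c^-1 * _ = l ^+ 3 / (c * s))//; field; rewrite ?cN ?sN ?pN.
apply: le_trans (lerD (lexx _) h3) _.
set w := l ^+ 3 / s.
have w0 : 0 <= w by rewrite divr_ge0//; [apply: exprn_ge0; exact: ltW|exact: ltW].
rewrite (mulrA 2) -mulrDl; apply: ler_wpM2r => //.
rewrite -(@ler_pM2r _ (c ^+ 2)) ?exprn_gt0//.
have -> : 15 * K ^+ 2 / c ^+ 2 * c ^+ 2 = 15 * K ^+ 2 by field; rewrite ?cN ?sN ?pN.
have -> : (2 * (K / c ^+ 2 + 2 * K * (K + 2) / c) + K / c) * c ^+ 2 =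
  2 * K + c * (4 * K ^+ 2 + 9 * K) by field; rewrite ?cN ?sN ?pN.
have kk : K <= K ^+ 2 by rewrite expr2 ler_peMr//; lra.
have : c * (4 * K ^+ 2 + 9 * K) <= 4 * K ^+ 2 + 9 * K.
  by rewrite ler_piMl//; lra.
by lra.
Qed.

(** * Concentration for independent Bernoulli variables *)

Section Hoeffding.
Variable R : realType.

(** It bounds the exponential moment of a centred variable x by that of
    exp (2 x^2), as the linear term has mean zero. *)
Lemma expR_le_sqr (x : R) : expR x <= x + expR (2 * x ^+ 2).
Proof.
have h2 := expR_ge1Dx (2 * x ^+ 2).
have [x2|x2] := lerP x 2^-1; last first.
  have : expR x <= expR (2 * x ^+ 2) by rewrite ler_expR; nra.
  by lra.
have e1 : expR x * (1 - x) <= 1.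
  have := expR_ge1Dx (- x); rewrite expRN => h.
  apply: (@le_trans _ _ (expR x * (expR x)^-1)).
    by rewrite ler_wpM2l ?expR_ge0//; lra.
  by rewrite divff// gt_eqF// expR_gt0.
have : expR x <= 1 + x + 2 * x ^+ 2.
  rewrite -(@ler_pM2r _ (1 - x)); last lra.
  apply: le_trans e1 _.
  have -> : (1 + x + 2 * x ^+ 2) * (1 - x) = 1 + x ^+ 2 * (1 - 2 * x) by ring.
  by rewrite lerDl mulr_ge0 ?sqr_ge0//; lra.
by lra.
Qed.

Lemma bernoulli_mgf (p c K : R) : 0 <= p <= 1 -> `|c| <= K ->
  p * expR (c * (1 - p)) + (1 - p) * expR (c * (0 - p)) <= expR (2 * K ^+ 2).
Proof.
move=> /andP[p0 p1] cK.
have K0 : 0 <= K by apply: le_trans cK.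
have c2 : c ^+ 2 <= K ^+ 2.
  by rewrite -real_normK ?num_real//; apply: lerXn2r; rewrite ?nnegrE.
have b y : `|y| <= 1 -> expR (c * y) <= c * y + expR (2 * K ^+ 2).
  move=> y1; apply: le_trans (expR_le_sqr _) _; rewrite lerD2l ler_expR.
  rewrite ler_pM2l// exprMn; apply: le_trans c2; rewrite ler_piMr ?sqr_ge0//.
  by rewrite -real_normK ?num_real// expr_le1.
have b1 : expR (c * (1 - p)) <= c * (1 - p) + expR (2 * K ^+ 2).
  by apply: b; rewrite ger0_norm; lra.
have b0 : expR (c * (0 - p)) <= c * (0 - p) + expR (2 * K ^+ 2).
  by apply: b; rewrite ler0_norm; lra.
have p1' : 0 <= 1 - p by lra.
have := lerD (ler_wpM2l p0 b1) (ler_wpM2l p1' b0).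
move=> /le_trans; apply; rewrite le_eqVlt; apply/orP; left; apply/eqP; ring.
Qed.

End Hoeffding.

Section BernoulliProduct.
Variables (R : realType) (I : finType) (p : R).
Local Notation V := {ffun I -> bool}.
Implicit Types (v : V) (f g F : V -> R) (B : pred V).

(** The law of independent Bernoulli variables of parameter p is handled through
    finite sums over {ffun I -> bool}; only its image is a law on the
    probability space of the graph. *)
Definition weight v : R := \prod_i (if v i then p else 1 - p).

Definition mean f : R := \sum_v weight v * f v.

Definition prob B : R := mean (fun v => (B v)%:R).

Definition update v (e : I) (b : bool) : V :=
  [ffun i => if i == e then b else v i].

Definition invariant_at (T : Type) (e : I) (f : V -> T) :=
  forall v b, f (update v e b) = f v.

Definition centered v (e : I) : R := (v e)%:R - p.

Hypothesis p01 : 0 <= p <= 1.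

Lemma weight_ge0 v : 0 <= weight v.
Proof.
have /andP[p0 p1] := p01.
by apply: prodr_ge0 => i _; case: ifP; rewrite ?subr_ge0.
Qed.

Lemma ler_mean f g : (forall v, f v <= g v) -> mean f <= mean g.
Proof. by move=> fg; apply: ler_sum => v _; rewrite ler_wpM2l ?weight_ge0. Qed.

Lemma meanZ c f : mean (fun v => c * f v) = c * mean f.
Proof. by rewrite /mean mulr_sumr; apply: eq_bigr => v _; rewrite mulrCA. Qed.

Lemma meanD f g : mean (fun v => f v + g v) = mean f + mean g.
Proof. by rewrite /mean -big_split; apply: eq_bigr => v _; rewrite mulrDr. Qed.

Lemma mean_sum (T : finType) (f : T -> V -> R) :
  mean (fun v => \sum_t f t v) = \sum_t mean (f t).
Proof.
by rewrite /mean exchange_big /=; apply: eq_bigr => v _; rewrite mulr_sumr.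
Qed.

(** Averaging over one coordinate leaves the mean unchanged: pair each point with
    the one obtained by flipping that coordinate. *)
Lemma mean_update e f :
  mean f = mean (fun v => p * f (update v e true) + (1 - p) * f (update v e false)).
Proof.
pose q (b : bool) : R := if b then p else 1 - p.
pose r v := \prod_(i | i != e) q (v i).
pose flip v := update v e (~~ v e).
have flipK : involutive flip.
  move=> v; apply/ffunP => i; rewrite /flip /update !ffunE eqxx.
  by case: eqVneq => // ->; rewrite negbK.
have flipe v : flip v e = ~~ v e by rewrite ffunE eqxx.
have rflip v : r (flip v) = r v.
  by apply: eq_bigr => i /negPf ie; rewrite ffunE ie.
have wE v : weight v = q (v e) * r v by rewrite /weight (bigD1 e).
have upd_id v : update v e (v e) = v.
  by apply/ffunP => i; rewrite ffunE; case: eqVneq => // ->.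
have mixE v : p * f (update v e true) + (1 - p) * f (update v e false) =
    q (v e) * f v + q (~~ v e) * f (flip v).
  by have := upd_id v; rewrite /flip; case: (v e) => /= -> //; rewrite addrC.
transitivity (\sum_(v : V) q (v e) * r v * (q (v e) * f v)
   + \sum_(v : V) q (v e) * r v * (q (~~ v e) * f (flip v))); last first.
  rewrite -big_split; apply: eq_bigr => v _ /=.
  by rewrite mixE wE mulrDr.
rewrite [X in _ = _ + X](reindex_inj (inv_inj flipK)) /=.
rewrite -big_split; apply: eq_bigr => v _ /=.
rewrite wE flipK rflip flipe negbK /q; case: (v e) => /=; ring.
Qed.

Lemma mean1 : mean (fun=> 1) = 1.
Proof.
rewrite /mean (eq_bigr (fun v : V => \prod_i (if v i then p else 1 - p))); last first.
  by move=> v _; rewrite mulr1.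
rewrite -(bigA_distr_bigA (fun i (b : bool) => if b then p else 1 - p)) /=.
by rewrite big1// => i _; rewrite big_bool /=; ring.
Qed.

Lemma mean_cst c : mean (fun=> c) = c.
Proof. by rewrite -[in RHS](mulr1 c) -mean1 -meanZ; under [RHS]eq_bigr do rewrite mulr1. Qed.

Lemma mean_centered e : mean (fun v => centered v e) = 0.
Proof.
rewrite (mean_update e) -[RHS](mean_cst 0); apply: eq_bigr => v _.
by rewrite /centered !ffunE eqxx /=; congr (_ * _); ring.
Qed.

Lemma prob_sub B B' : (forall v, B v -> B' v) -> prob B <= prob B'.
Proof.
move=> BB; apply: ler_mean => v; rewrite ler_nat.
by case: (B v) (BB v) => // ->.
Qed.

Lemma prob_or B B' : prob (fun v => B v || B' v) <= prob B + prob B'.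
Proof.
rewrite -meanD; apply: ler_mean => v.
by case: (B v); case: (B' v); rewrite /= ?add0r ?addr0// lerDl.
Qed.

Lemma prob_exists (T : finType) (B : T -> pred V) b :
  (forall t, prob (B t) <= b) -> prob (fun v => [exists t, B t v]) <= #|T|%:R * b.
Proof.
move=> Bb; apply: (@le_trans _ _ (\sum_t prob (B t))).
  rewrite -mean_sum; apply: ler_mean => v.
  have [/existsP[t Bt]|_] := boolP [exists t, B t v]; last exact: sumr_ge0.
  by rewrite (bigD1 t)//= Bt lerDl sumr_ge0.
by rewrite mulr_natl -sumr_const; apply: ler_sum.
Qed.

(** The coordinates are revealed from the end of s to its head: the coefficient
    of f may depend on what stands after f in s, and on coordinates outside s. *)
Definition predictable (s : seq I) (c : I -> V -> R) :=
  forall e (f : I), e \in s -> f \in s -> (index e s <= index f s)%N ->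
    invariant_at e (c f).

(** One step of Azuma's argument: only the coordinate e of the last factor is
    averaged, the rest being frozen. *)
Lemma mean_exp_step e F (c : V -> R) K : (forall v, 0 <= F v) ->
  invariant_at e F -> invariant_at e c -> (forall v, `|c v| <= K) ->
  mean (fun v => F v * expR (c v * centered v e)) <= expR (2 * K ^+ 2) * mean F.
Proof.
move=> F0 Fe ce cK; rewrite (mean_update e) -meanZ; apply: ler_mean => v.
rewrite !Fe !ce /centered !ffunE eqxx /=.
have -> : p * (F v * expR (c v * (1 - p))) + (1 - p) * (F v * expR (c v * (0 - p)))
  = (p * expR (c v * (1 - p)) + (1 - p) * expR (c v * (0 - p))) * F v by ring.
by rewrite ler_wpM2r//; exact: bernoulli_mgf.
Qed.

Lemma predictable_mgf (s : seq I) (c : I -> V -> R) (K : I -> R) : uniq s ->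
  predictable s c -> (forall e v, e \in s -> `|c e v| <= K e) ->
  mean (fun v => expR (\sum_(e <- s) c e v * centered v e)) <=
    expR (2 * \sum_(e <- s) K e ^+ 2).
Proof.
elim: s => [_ _ _|e s IHs /= /andP[es us] pc cK].
  under [leLHS]eq_bigr do rewrite big_nil expR0.
  by rewrite -[leLHS]/(mean (fun=> 1)) mean1 big_nil mulr0 expR0.
have ne (f : I) : f \in s -> (e == f) = false by move=> fs; apply: contraNF es => /eqP ->.
have pcs : predictable s c.
  move=> f g fs gs fg; apply: pc; rewrite ?inE ?fs ?gs ?orbT//=.
  by rewrite !ne.
have pe (f : I) : f \in e :: s -> invariant_at e (c f).
  by move=> fs; apply: pc; rewrite ?mem_head//= eqxx.
rewrite big_cons mulrDr expRD.
under [leLHS]eq_bigr do rewrite big_cons addrC expRD.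
apply: le_trans (mean_exp_step (e := e) (K := K e) _ _ _ _) _.
- by move=> v; exact: expR_ge0.
- move=> v b; congr expR; apply: eq_big_seq => f fs.
  rewrite pe ?inE ?fs ?orbT// /centered ffunE.
  by rewrite eq_sym ne.
- by apply: pe; rewrite mem_head.
- by move=> v; apply: cK; rewrite mem_head.
rewrite ler_wpM2l ?expR_ge0//; apply: IHs => // f v fs.
by apply: cK; rewrite inE fs orbT.
Qed.

(** Azuma-Hoeffding inequality.  The coefficients need to be small only on the
    event whose probability is bounded: they can be truncated without losing
    predictability, and on that event truncation changes nothing. *)
Lemma predictable_tail (s : seq I) (c : I -> V -> R) (K : I -> R) (w l : R) :
  uniq s -> predictable s c -> 0 < w -> \sum_(e <- s) K e ^+ 2 <= w ^+ 2 ->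
  (forall e, 0 <= K e) -> 0 <= l ->
  prob (fun v => (3 * w * l < `|\sum_(e <- s) c e v * centered v e|)
                 && all (fun e => `|c e v| <= K e) s) <= 2 * expR (- l ^+ 2).
Proof.
move=> us pc w0 Kw K0 l0.
pose c' e v := Num.max (- K e) (Num.min (K e) (c e v)).
have c'K e v : `|c' e v| <= K e.
  rewrite ler_norml /c' le_max lexx /= ge_max ge_min lexx /= andbT.
  by have := K0 e; lra.
have pc' : predictable s c'.
  by move=> e f es fs ef v b; rewrite /c' pc.
have c'E v : all (fun e => `|c e v| <= K e) s ->
    \sum_(e <- s) c' e v * centered v e = \sum_(e <- s) c e v * centered v e.
  move=> /allP cK; apply: eq_big_seq => e es; congr (_ * _).
  have := cK _ es; rewrite /= ler_norml /c' => /andP[h1 h2].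
  by rewrite min_r// max_r.
pose X v := \sum_(e <- s) c' e v * centered v e.
(* minimises the exponent - 3 w l t + 2 w^2 t^2 *)
pose t := 3 * l / (4 * w).
have t0 : 0 <= t by rewrite divr_ge0//; lra.
have side (sg : R) : sg = 1 \/ sg = -1 ->
    mean (fun v => expR (t * (sg * X v - 3 * w * l))) <= expR (- l ^+ 2).
  move=> sg1.
  have := @predictable_mgf s (fun e v => t * sg * c' e v) (fun e => t * K e) us.
  have -> : (fun v => expR (t * (sg * X v - 3 * w * l))) = (fun v =>
    expR (- (t * (3 * w * l))) * expR (\sum_(e <- s) t * sg * c' e v * centered v e)).
    apply/funext => v; rewrite -expRD; congr expR.
    under eq_bigr do rewrite -mulrA.
    by rewrite -mulr_sumr -/(X v); ring.
  rewrite meanZ => h.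
  apply: le_trans (ler_wpM2l (expR_ge0 _) (h _ _)) _.
  - by move=> e f es fs ef v b; rewrite pc'.
  - move=> e v es; rewrite normrM; apply: ler_pM => //.
    by rewrite normrM (ger0_norm t0); case: sg1 => ->; rewrite ?normrN normr1 mulr1.
  rewrite -expRD ler_expR.
  under eq_bigr do rewrite exprMn.
  rewrite -mulr_sumr.
  apply: (@le_trans _ _ (- (t * (3 * w * l)) + 2 * (t ^+ 2 * w ^+ 2))).
    by rewrite lerD2l ler_pM2l// ler_wpM2l ?sqr_ge0.
  have -> : - (t * (3 * w * l)) + 2 * (t ^+ 2 * w ^+ 2) = - (9 / 8 * l ^+ 2).
    by rewrite /t; field; lra.
  by rewrite lerN2; have := sqr_ge0 l; lra.
apply: (@le_trans _ _ (mean (fun v => expR (t * (1 * X v - 3 * w * l))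
    + expR (t * (-1 * X v - 3 * w * l))))).
  apply: ler_mean => v; case: andP => [[Xv cv]|_]; last by rewrite addr_ge0 ?expR_ge0.
  rewrite -(c'E _ cv) -/(X v) in Xv.
  have e1 y : 0 <= y -> 1 <= expR y by move=> y0; rewrite -expR0 ler_expR.
  move: Xv; rewrite ltr_normr => /orP[] Xv.
    by rewrite -[leLHS]addr0; apply: lerD; rewrite ?expR_ge0// e1// mulr_ge0//; lra.
  by rewrite -[leLHS]add0r; apply: lerD; rewrite ?expR_ge0// e1// mulr_ge0//; lra.
have s1 := side 1 (or_introl erefl); have s2 := side (-1) (or_intror erefl).
by rewrite meanD; lra.
Qed.

End BernoulliProduct.

(** * Walk counts of the random graph at a fixed time *)

Section Edges.
Variable n : nat.

(** Unordered pairs with loops, indexed like the independent edge processes. *)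
Definition edges := {e : 'I_n * 'I_n | (e.1 <= e.2)%N}.

Definition sort_pair (i j : 'I_n) : 'I_n * 'I_n := if (i <= j)%N then (i, j) else (j, i).

Lemma sort_pair_le i j : ((sort_pair i j).1 <= (sort_pair i j).2)%N.
Proof. by rewrite /sort_pair; case: (leqP i j) => //= /ltnW. Qed.

Definition edge i j : edges := exist _ (sort_pair i j) (sort_pair_le i j).

Lemma edgeC i j : edge i j = edge j i.
Proof.
apply: val_inj; rewrite /= /sort_pair; case: (ltngtP i j) => // ij.
by rewrite (val_inj ij).
Qed.

Lemma edge_val (e : edges) : edge (val e).1 (val e).2 = e.
Proof. by apply: val_inj; case: e => -[i j] /= ij; rewrite /sort_pair ij. Qed.

Definition incident (e : edges) i := ((val e).1 == i) || ((val e).2 == i).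

Definition other i (e : edges) := if (val e).1 == i then (val e).2 else (val e).1.

Lemma incident_edge i j k : incident (edge i j) k = (i == k) || (j == k).
Proof. by rewrite /incident /= /sort_pair; case: ifP => //=; rewrite orbC. Qed.

Lemma other_edge i j : other i (edge i j) = j.
Proof.
rewrite /other /= /sort_pair; case: (leqP i j) => ij /=; rewrite ?eqxx//.
by case: eqP => // ->.
Qed.

Lemma edge_other i e : incident e i -> edge i (other i e) = e.
Proof.
have := edge_val e; rewrite /incident /other.
by case: eqVneq => [-> //|_ h /= /eqP <-]; rewrite edgeC.
Qed.

Lemma edge_inj i : injective (edge i).
Proof. by move=> j k jk; rewrite -[LHS](other_edge i) jk other_edge. Qed.

Lemma edge_neq i j k k' : j != i -> k != i -> edge j k <> edge i k'.
Proof.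
move=> ji ki /(congr1 (incident ^~ i)); rewrite !incident_edge eqxx.
by rewrite (negPf ji) (negPf ki).
Qed.

Lemma card_edges : (#|{: edges}| <= n * n)%N.
Proof.
rewrite -[X in (_ <= X * _)%N]card_ord -[X in (_ <= _ * X)%N]card_ord -card_prod.
exact: leq_card val_inj.
Qed.

Lemma sum_incident (R : nmodType) i (f : edges -> R) :
  \sum_(e | incident e i) f e = \sum_j f (edge i j).
Proof.
rewrite (reindex_onto (edge i) (other i)) => [|e]; last exact: edge_other.
by apply: eq_bigl => j; rewrite incident_edge eqxx other_edge eqxx.
Qed.

Fact after_key : unit. Proof. by []. Qed.

(** An arbitrary order on the edges.  It is locked so that comparing two of its
    instances does not unfold the enumeration of the edges. *)
Definition after := locked_with after_key
  (fun e f : edges => (index e (enum {: edges}) < index f (enum {: edges}))%N).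

Lemma afterE e f :
  after e f = (index e (enum {: edges}) < index f (enum {: edges}))%N.
Proof. by rewrite /after unlock. Qed.

Lemma after_irr e : after e e = false.
Proof. by rewrite afterE ltnn. Qed.

Lemma afterN e f : (f != e) && ~~ after e f = after f e.
Proof.
rewrite !afterE -leqNgt leq_eqVlt; case: eqVneq => [->|fe]; first by rewrite ltnn.
case: eqVneq => //= ief; case/eqP: fe.
by apply: (@index_inj _ e (enum {: edges})); rewrite ?mem_enum.
Qed.

End Edges.

Section RandomGraph.
Variables (R : realType) (n : nat) (p s l : R).
Hypotheses (p01 : 0 <= p <= 1) (s0 : 0 < s) (sn : s ^+ 2 = n%:R) (l1 : 1 <= l).
Local Notation E := (edges n).
Local Notation V := {ffun E -> bool}.
Local Notation Pr := (@prob R E p).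

Definition noise (v : V) (i j : 'I_n) : R := centered p v (edge i j).

Lemma noiseC v i j : noise v i j = noise v j i.
Proof. by rewrite /noise edgeC. Qed.

Lemma centered_le1 (v : V) e : `|centered p v e| <= 1.
Proof.
have /andP[p0 p1] := p01.
by rewrite /centered ler_norml; case: (v e) => /=; apply/andP; split; lra.
Qed.

Lemma noise_le1 v i j : `|noise v i j| <= 1.
Proof. exact: centered_le1. Qed.

Lemma isolate_invariant i k v b :
  isolate (noise (update v (edge i k) b)) i = isolate (noise v) i.
Proof.
apply/funext => j; apply/funext => m; rewrite /isolate.
have [//|ji] := eqVneq j i; have [//|mi /=] := eqVneq m i.
rewrite /noise /centered ffunE; case: eqP => // jm.
by case: (edge_neq ji mi jm).
Qed.

(** The whole row i is revealed after all other edges, so that coefficients which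
    ignore this row are predictable. *)
Lemma row_tail i (c : 'I_n -> V -> R) (M : R) : 0 < M ->
  (forall j k, invariant_at (edge i k) (c j)) ->
  Pr (fun v => (3 * (s * M) * l < `|\sum_j noise v i j * c j v|)
        && [forall j, `|c j v| <= M]) <= 2 * expR (- l ^+ 2).
Proof.
move=> M0 ci.
pose t := [seq edge i j | j <- enum 'I_n].
have ut : uniq t by rewrite map_inj_uniq ?enum_uniq//; exact: edge_inj.
have l0 : 0 <= l := le_trans ler01 l1.
have sM : 0 < s * M by rewrite mulr_gt0.
have := @predictable_tail R E p p01 t (fun e => c (other i e)) (fun=> M) _ l ut _ sM.
move=> /(_ _ _ (fun=> ltW M0) l0) h.
apply: le_trans (h _ _); last 2 first.
- by move=> e f /mapP[j _ ->] _ _; exact: ci.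
- by rewrite big_map big_enum /= sumr_const card_ord -[leLHS]mulr_natl -sn exprMn.
apply: prob_sub => // v /andP[h1 /forallP h2]; apply/andP; split.
  rewrite big_map big_enum /= (eq_bigr (fun j => noise v i j * c j v))//.
  by move=> j _; rewrite other_edge mulrC.
by apply/allP => e /mapP[j _ ->] /=.
Qed.

Lemma edge_tail (c : E -> V -> R) (K : E -> R) w : 0 < w -> (forall e, 0 <= K e) ->
  \sum_e K e ^+ 2 <= w ^+ 2 ->
  (forall e f : E, (index e (enum {: E}) <= index f (enum {: E}))%N -> invariant_at e (c f)) ->
  Pr (fun v => (3 * w * l < `|\sum_e c e v * centered p v e|)
        && [forall e, `|c e v| <= K e]) <= 2 * expR (- l ^+ 2).
Proof.
move=> w0 K0 Kw pc; have l0 : 0 <= l := le_trans ler01 l1.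
have := @predictable_tail R E p p01 (enum {: E}) c K w l (enum_uniq _) _ w0.
rewrite big_enum /= => /(_ _ Kw K0 l0) h.
apply: le_trans (h _); last by move=> e f _ _; exact: pc.
apply: prob_sub => // v /andP[h1 /forallP h2]; rewrite big_enum h1 /=.
by apply/allP => e _.
Qed.

(** Part of the i-th row sum that is known when e is about to be revealed. *)
Definition revealed (v : V) (e : E) (i : 'I_n) : R :=
  \sum_(f | after e f && incident f i) centered p v f.

(** Revealing e adds h_e to the row sums at its endpoints, hence changes the sum
    of the squared row sums by h_e times this coefficient, plus h_e^2 for each
    endpoint. *)
Definition sqr_coef (e : E) (v : V) : R :=
  2 * \sum_(i | incident e i) revealed v e i.

Lemma walks1_incident v i :
  walks (noise v) 1 i = \sum_(e | incident e i) centered p v e.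
Proof. by rewrite walks1 sum_incident. Qed.

Lemma card_incident (e : E) : (\sum_(i | incident e i) 1 <= 2 :> R)%R.
Proof.
rewrite sumr_const; rewrite ler_nat.
apply: leq_trans (_ : #|pred2 (val e).1 (val e).2| <= 2)%N; last first.
  by rewrite card2; case: (_ != _).
by apply: subset_leq_card; apply/fintype.subsetP => i; rewrite !inE unfold_in eq_sym (eq_sym _ i).
Qed.

Lemma sum_sqr_walks1 v : \sum_i walks (noise v) 1 i ^+ 2 =
  \sum_e sqr_coef e v * centered p v e + \sum_i \sum_j noise v i j ^+ 2.
Proof.
have sqE i : walks (noise v) 1 i ^+ 2 =
   \sum_(e | incident e i) 2 * revealed v e i * centered p v e
   + \sum_j noise v i j ^+ 2.
  rewrite walks1_incident -(sum_incident i (fun e => centered p v e ^+ 2)).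
  rewrite expr2 mulr_suml.
  have -> : \sum_(e | incident e i) centered p v e * \sum_(f | incident f i) centered p v f
    = \sum_(e | incident e i) (revealed v e i * centered p v e
       + (\sum_(f | after f e && incident f i) centered p v f) * centered p v e
       + centered p v e ^+ 2).
    apply: eq_bigr => e ei.
    rewrite (bigD1 e)//= (bigID (after e)) /= mulrDr -expr2 [LHS]addrC; congr (_ + _).
    rewrite /revealed -mulrDl [LHS]mulrC; congr ((_ + _) * _); apply: eq_bigl => f.
      by rewrite -andbA andbC; case: eqVneq => [->|_]; rewrite ?after_irr.
    by rewrite -andbA afterN andbC.
  rewrite !big_split /=; congr (_ + _).
  have -> : \sum_(e | incident e i)
        (\sum_(f | after f e && incident f i) centered p v f) * centered p v e
      = \sum_(e | incident e i) revealed v e i * centered p v e.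
    transitivity (\sum_(e | incident e i) \sum_(f | after f e && incident f i)
        centered p v f * centered p v e).
      by apply: eq_bigr => e _; rewrite mulr_suml.
    rewrite (exchange_big_dep (fun f => incident f i)) /=; last by move=> e f _ /andP[].
    apply: eq_bigr => f fi; rewrite /revealed mulr_suml; apply: eq_big => [e|e _]; last exact: mulrC.
    by rewrite fi andbT andbC.
  by rewrite -big_split /=; apply: eq_bigr => e _; ring.
under eq_bigr do rewrite sqE.
rewrite big_split /=; congr (_ + _).
rewrite (exchange_big_dep predT) //=; apply: eq_bigr => e _.
by rewrite /sqr_coef mulr_sumr mulr_suml.
Qed.

(** For a Bernoulli variable a, (a - p)^2 - p (1 - p) = (1 - 2 p) (a - p): the
    diagonal part of the quadratic statistic is again linear. *)
Lemma sum_sqr_noise v : \sum_i \sum_j noise v i j ^+ 2 - s ^+ 4 * (p * (1 - p)) =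
  (1 - 2 * p) * \sum_i walks (noise v) 1 i.
Proof.
have sqE i j : noise v i j ^+ 2 = (1 - 2 * p) * noise v i j + p * (1 - p).
  by rewrite /noise /centered; case: (v _) => /=; ring.
under eq_bigr do (under eq_bigr do rewrite sqE; rewrite big_split /= -mulr_sumr -walks1).
rewrite big_split /= -mulr_sumr !sumr_const card_ord.
rewrite -mulrnA -[_ *+ (n * n)]mulr_natl natrM -sn.
by move: (\sum_i _) => D; ring.
Qed.

Definition exceeds (J : finType) (b x : R) (c K : J -> R) : bool :=
  (b < `|x|) && [forall j, `|c j| <= K j].

Definition row_exceeds (v : V) (M : R) (c : 'I_n -> R) i : bool :=
  exceeds (3 * (s * M) * l) (\sum_j noise v i j * c j) c (fun=> M).

Definition edge_exceeds (v : V) (w : R) (c K : E -> R) : bool :=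
  exceeds (3 * w * l) (\sum_e c e * centered p v e) c K.

Definition row_sum_large (v : V) : bool := [exists i, row_exceeds v 1 (fun=> 1) i].

Definition cross_row_large (v : V) : bool := [exists ij : 'I_n * 'I_n,
  row_exceeds v 1 (isolate (noise v) ij.1 ij.2) ij.1].

Definition walks2_large (v : V) : bool := [exists i,
  row_exceeds v (4 * (s * l)) (walks (isolate (noise v) i) 1) i].

Definition walks3_large (v : V) : bool := [exists i,
  row_exceeds v (22 * (s ^+ 2 * l ^+ 2)) (walks (isolate (noise v) i) 2) i].

Definition revealed_large (v : V) : bool := [exists ei : E * 'I_n,
  edge_exceeds v s (fun e => (after ei.1 e && incident e ei.2)%:R)
    (fun e => (incident e ei.2)%:R)].

Definition total_large (v : V) : bool :=
  edge_exceeds v (2 * s ^+ 2) (fun e => \sum_(i | incident e i) 1) (fun=> 2).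

Definition sqr_large (v : V) : bool :=
  edge_exceeds v (12 * s ^+ 3 * l) (sqr_coef ^~ v) (fun=> 12 * (s * l)).

Definition bad (v : V) : bool :=
  [|| row_sum_large v, cross_row_large v, walks2_large v, walks3_large v, revealed_large v, total_large v | sqr_large v].

Lemma n_gt0 : (0 < n)%N.
Proof. by rewrite -(ltr0n R) -sn exprn_gt0. Qed.

(** At most 8 n^3 deviations are excluded, each of probability at most
    2 exp (- l^2). *)
Lemma prob_bad : Pr bad <= 16 * n%:R ^+ 3 * expR (- l ^+ 2).
Proof.
have [l1' s0'] := (l1, s0).
set b := 2 * expR (- l ^+ 2).
have b0 : 0 <= b by rewrite mulr_ge0 ?expR_ge0.
set N : R := n%:R.
have n1 : 1 <= N by rewrite ler1n n_gt0.
have sl0 : 0 < s * l by rewrite mulr_gt0//; lra.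
have s2l2 : 0 < s ^+ 2 * l ^+ 2 by rewrite mulr_gt0// exprn_gt0//; lra.
have rowb (c : V -> 'I_n -> 'I_n -> R) M : 0 < M ->
   (forall v i k b, c (update v (edge i k) b) i = c v i) ->
   Pr (fun v => [exists i, row_exceeds v M (c v i) i]) <= N * b.
  move=> M0 cu; rewrite /N -[X in X%:R]card_ord; apply: prob_exists => // i.
  apply: (@row_tail i (fun j v => c v i j)) => // j k v bb.
  by rewrite cu.
have h1 : Pr row_sum_large <= N * b by exact: (rowb (fun _ _ _ => 1)).
have h2 : Pr cross_row_large <= N * N * b.
  rewrite /N -natrM -[X in (X * _)%:R]card_ord -[X in (_ * X)%:R]card_ord -card_prod.
  apply: prob_exists => // ij.
  apply: (@row_tail ij.1 (fun k v => isolate (noise v) ij.1 ij.2 k)) => // j k v bb.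
  by rewrite isolate_invariant.
have h3 : Pr walks2_large <= N * b.
  apply: (rowb (fun v i j => walks (isolate (noise v) i) 1 j)); first by rewrite mulr_gt0.
  by move=> v i k bb; rewrite isolate_invariant.
have h4 : Pr walks3_large <= N * b.
  apply: (rowb (fun v i j => walks (isolate (noise v) i) 2 j)); first by rewrite mulr_gt0.
  by move=> v i k bb; rewrite isolate_invariant.
have cE : #|{: E}|%:R <= N * N by rewrite -natrM ler_nat card_edges.
have h5 : Pr revealed_large <= N * N * N * b.
  apply: (@le_trans _ _ (#|{: E * 'I_n}|%:R * b)); last first.
    by rewrite ler_wpM2r// card_prod natrM card_ord ler_wpM2r.
  apply: prob_exists => // ei.
  apply: (@edge_tail (fun e v => (after ei.1 e && incident e ei.2)%:R)
    (fun e => (incident e ei.2)%:R)) => //.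
  rewrite (eq_bigr (fun e => if incident e ei.2 then 1 else 0)); last first.
    by move=> e _; case: incident; rewrite ?expr1n// expr0n.
  by rewrite -big_mkcond sum_incident sumr_const card_ord sn.
have cE2 (c : R) : \sum_(e : E) c ^+ 2 <= (s ^+ 2 * c) ^+ 2.
  rewrite sumr_const -[leLHS]mulr_natl exprMn; apply: ler_wpM2r; first exact: sqr_ge0.
  by rewrite sn expr2.
have h6 : Pr total_large <= b.
  apply: (@edge_tail (fun e _ => \sum_(i | incident e i) 1) (fun=> 2)) => //.
    by rewrite mulr_gt0// exprn_gt0.
  by rewrite (mulrC 2).
have h7 : Pr sqr_large <= b.
  apply: (@edge_tail sqr_coef (fun=> 12 * (s * l))).
  - by rewrite !mulr_gt0 ?exprn_gt0//; lra.
  - by move=> _; lra.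
  - apply: le_trans (cE2 _) _.
    by rewrite (_ : s ^+ 2 * _ = 12 * s ^+ 3 * l)//; ring.
  move=> e f ef v bb; rewrite /sqr_coef; congr (_ * _); apply: eq_bigr => i _.
  apply: eq_bigr => g /andP[fg _]; rewrite /centered ffunE; case: eqVneq => // ge.
  by move: fg; rewrite ge afterE ltnNge ef.
have hbad : Pr bad <= Pr row_sum_large + (Pr cross_row_large + (Pr walks2_large + (Pr walks3_large +
    (Pr revealed_large + (Pr total_large + Pr sqr_large))))).
  by do 5 (apply: le_trans (prob_or _ _ _) _ => //; rewrite lerD2l); exact: prob_or.
apply: le_trans hbad _.
have -> : 16 * N ^+ 3 * expR (- l ^+ 2) = 8 * N ^+ 3 * b by rewrite /b; ring.
apply: (@le_trans _ _ ((3 * N + N ^+ 2 + N ^+ 3 + 2) * b)).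
  have -> : (3 * N + N ^+ 2 + N ^+ 3 + 2) * b = N * b + (N * N * b + (N * b +
    (N * b + (N * N * N * b + (b + b))))) by ring.
  by rewrite !lerD.
rewrite ler_wpM2r//.
have N2 : N <= N ^+ 2 by rewrite expr2 ler_peMr//; lra.
have N3 : N ^+ 2 <= N ^+ 3 by rewrite exprS ler_peMl// sqr_ge0.
by lra.
Qed.

(** The truncation conditions inside the excluded events hold automatically on
    the good event, because each of them is a consequence of the bounds that
    come before it. *)
Lemma regular_noise v : 1 <= s -> ~~ bad v -> regular (noise v) p s l 88.
Proof.
have l1' := l1; have /andP[p0 p1] := p01.
move=> s1; rewrite /bad !negb_or.
move=> /and5P[/existsPn t1 /existsPn t2 /existsPn t3 /existsPn t4].
move=> /and3P[/existsPn t5 t6 t7].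
rewrite /row_exceeds /edge_exceeds /exceeds in t1 t2 t3 t4 t5.
rewrite /total_large /sqr_large /edge_exceeds /exceeds in t6 t7.
have sl1 : 1 <= s * l by rewrite mulr_ege1.
have g1 i : `|walks (noise v) 1 i| <= 3 * (s * l).
  have := t1 i; rewrite negb_and -leNgt => /orP[]; last first.
    by move=> /forallPn[j]; rewrite normr1 lexx.
  by rewrite mulr1 mulrA.
have isolate1 i j k : `|isolate (noise v) i j k| <= 1.
  by rewrite /isolate; case: ifP; rewrite ?normr0// noise_le1.
have [|r1 r2 r3] := row_bounded_walks (noiseC v) (noise_le1 v) s1 l1 sn.
  split=> //.
  - move=> i j _; have := t2 (i, j); rewrite negb_and -leNgt => /orP[]; last first.
      by move=> /forallPn[k]; rewrite isolate1.
    by rewrite mulr1 mulrA.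
  - move=> h i; have := t3 i; rewrite negb_and -leNgt => /orP[]; last first.
      by move=> /forallPn[j]; rewrite h.
    by move=> /le_trans; apply; rewrite le_eqVlt; apply/orP; left; apply/eqP; ring.
  - move=> h i; have := t4 i; rewrite negb_and -leNgt => /orP[]; last first.
      by move=> /forallPn[j]; rewrite h.
    by move=> /le_trans; apply; rewrite le_eqVlt; apply/orP; left; apply/eqP; ring.
have o1 : s ^+ 2 * l <= s ^+ 3 * l ^+ 2.
  rewrite (_ : s ^+ 3 * l ^+ 2 = (s * l) * (s ^+ 2 * l)); last by ring.
  by rewrite ler_peMl// mulr_ge0 ?sqr_ge0//; lra.
have rs : `|\sum_i walks (noise v) 1 i| <= 6 * (s ^+ 2 * l).
  move: t6; rewrite negb_and -leNgt => /orP[]; last first.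
    move=> /forallPn[e]; rewrite ger0_norm ?card_incident//.
    by apply: sumr_ge0.
  have -> : \sum_i walks (noise v) 1 i =
     \sum_e (\sum_(i | incident e i) 1) * centered p v e.
    under eq_bigr do rewrite walks1_incident.
    rewrite (exchange_big_dep predT)//=; apply: eq_bigr => e _.
    by rewrite mulr_suml; apply: eq_bigr => i _; rewrite mul1r.
  by move=> /le_trans; apply; rewrite le_eqVlt; apply/orP; left; apply/eqP; ring.
have rev e i : `|revealed v e i| <= 3 * (s * l).
  have := t5 (e, i); rewrite negb_and -leNgt => /orP[]; last first.
    move=> /forallPn[f] /=; rewrite ger0_norm// ler_nat.
    by case: after; case: incident.
  rewrite mulrA /revealed [in X in _ -> X]big_mkcond /=.
  rewrite (eq_bigr (fun f => if after e f && incident f i then centered p v f else 0))//.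
  by move=> f _; case: (_ && _); rewrite ?mul1r ?mul0r.
split=> // [|].
  apply: le_trans rs _.
  have : 0 <= s ^+ 2 * l by rewrite mulr_ge0 ?sqr_ge0//; lra.
  by lra.
have -> : \sum_i walks (noise v) 1 i ^+ 2 - s ^+ 4 * (p * (1 - p)) =
  \sum_e sqr_coef e v * centered p v e + (1 - 2 * p) * \sum_i walks (noise v) 1 i.
  by rewrite sum_sqr_walks1 -sum_sqr_noise addrA.
apply: le_trans (ler_normD _ _) _.
have : `|(1 - 2 * p) * \sum_i walks (noise v) 1 i| <= 1 * (6 * (s ^+ 2 * l)).
  by apply: ler_normM => //; rewrite ler_norml; lra.
have : `|\sum_e sqr_coef e v * centered p v e| <= 36 * (s ^+ 3 * l ^+ 2).
  move: t7; rewrite negb_and -leNgt => /orP[]; last first.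
    move=> /forallPn[e] /negP[]; rewrite /sqr_coef normrM ger0_norm//.
    have : `|\sum_(i | incident e i) revealed v e i| <= 2 * (3 * (s * l)).
      apply: le_trans (ler_norm_sum _ _ _) _.
      apply: (@le_trans _ _ (\sum_(i | incident e i) 1 * (3 * (s * l)))).
        by apply: ler_sum => i _; rewrite mul1r.
      rewrite -mulr_suml ler_wpM2r ?card_incident//; lra.
    by lra.
  by move=> /le_trans; apply; rewrite le_eqVlt; apply/orP; left; apply/eqP; ring.
have : 0 <= s ^+ 3 * l ^+ 2 by rewrite mulr_ge0 ?sqr_ge0// exprn_ge0// ltW.
by lra.
Qed.

End RandomGraph.

(** * Joint law of an arrival time and the next sojourn *)

Section JointLaw.
Context {R : realType} {d : measure_display} {Omega : measurableType d}.
Variable P : probability Omega R.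

Lemma preimage_measurable d' (T' : measurableType d') (X : Omega -> T') A :
  measurable_fun setT X -> measurable A -> measurable (X @^-1` A).
Proof. by move=> mX mA; rewrite -[X in measurable X]setTI; exact: mX. Qed.

(** A finite measure on the plane is determined by its values on rectangles. *)
Lemma joint_law (D : set Omega) (X Y : Omega -> R) (k : R) (m1 m2 : probability R R) :
  measurable D -> measurable_fun setT X -> measurable_fun setT Y -> 0 <= k ->
  (forall A B, measurable A -> measurable B ->
     P (D `&` (X @^-1` A `&` Y @^-1` B)) = (k%:E * (m1 A * m2 B))%E) ->
  forall C, measurable C ->
     P (D `&` (fun w => (X w, Y w)) @^-1` C) = (k%:E * (m1 \x m2) C)%E.
Proof.
move=> mD mX mY k0 rect C mC.
pose Z w := (X w, Y w).
have mZ : measurable_fun setT Z by exact: measurable_fun_pair.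
pose f C := P (D `&` Z @^-1` C).
have mZD A : measurable A -> measurable (D `&` Z @^-1` A).
  by move=> mA; apply: measurableI => //; exact: preimage_measurable.
have f0 : f set0 = 0%E by rewrite /f preimage_set0 setI0 measure0.
have fge A : (0 <= f A)%E by exact: measure_ge0.
have fsig : semi_sigma_additive f.
  move=> F mF tF mUF; rewrite /f preimage_bigcup setI_bigcupr.
  apply: measure_semi_sigma_additive.
  - by move=> n; exact: mZD.
  - apply/trivIsetP => i j _ _ ij.
    have FF : F i `&` F j = set0 by move/trivIsetP : tF; apply.
    apply/seteqP; split=> // w [[_ Fi] [_ Fj]].
    by have : (F i `&` F j) (Z w) by []; rewrite FF.
  - by rewrite -setI_bigcupr -preimage_bigcup; exact: mZD.
pose mf : {measure set (R * R) -> \bar R} := HB.pack f (isMeasure.Build _ _ _ f f0 fge fsig).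
pose mk : {measure set (R * R) -> \bar R} := mscale (NngNum k0) (m1 \x m2)%E.
suff: mf C = mk C by [].
apply: (measure_unique [set A `*` B | A in measurable & B in measurable] (fun=> setT)) => //.
- exact: measurable_prod_measurableType.
- move=> _ _ [A1 mA1 [B1 mB1 <-]] [A2 mA2 [B2 mB2 <-]].
  rewrite -setXI; exists (A1 `&` A2); first exact: measurableI.
  by exists (B1 `&` B2) => //; exact: measurableI.
- by move=> _; exists setT => //; exists setT => //; rewrite setXTT.
- by rewrite bigcup_const.
- move=> _ [A mA [B mB <-]].
  rewrite /mf /= /f /mk /= /mscale /= product_measure1E// -rect//.
- move=> _; rewrite /mf /= /f preimage_setT setIT.
  by apply: le_lt_trans (probability_le1 _ mD) _; rewrite ltry.
Qed.

(** [A0] stands for the event that fixes the initial state.  Independence is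
    expressed by the product rule over finite families of sojourns. *)
Section Renewal.
Variables (A0 : set Omega) (mA0 : measurable A0) (Y : nat -> {RV P >-> R}).
Variable nu : nat -> probability R R.
Hypothesis indep : forall (J : seq nat) (B : nat -> set R), uniq J ->
  (forall m, measurable (B m)) ->
  P (A0 `&` \bigcap_(m in [set` J]) Y m @^-1` B m) =
    (P A0 * \prod_(m <- J) nu m (B m))%E.

Definition arrival (l : nat) (w : Omega) : R := \sum_(m < l) Y m w.

Definition addp (z : R * R) : R := z.1 + z.2.

Lemma measurable_addp : measurable_fun setT addp.
Proof. by apply: measurable_realfun.measurable_funD. Qed.

HB.instance Definition _ := isMeasurableFun.Build _ _ _ _ addp measurable_addp.

Fixpoint arrival_law (l : nat) : probability R R :=
  if l is k.+1 then distribution (arrival_law k \x nu k)%E addp else \d_(0 : R).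

Lemma measurable_arrival l : measurable_fun setT (arrival l).
Proof. by apply: measurable_sum => m; exact: measurable_funPT. Qed.

Lemma measurable_future (J : seq nat) (B : nat -> set R) :
  (forall m, measurable (B m)) ->
  measurable (A0 `&` \bigcap_(m in [set` J]) Y m @^-1` B m).
Proof.
move=> mB; apply: measurableI => //; apply: bigcap_measurableType => m _.
by apply: preimage_measurable => //; exact: measurable_funPT.
Qed.

(** Induction on l.  The finitely many later sojourns Y_m, m > l, are carried
    along, since the step from l to l + 1 turns one of them into the next
    sojourn. *)
Lemma arrival_joint l (J : seq nat) (B : nat -> set R) : uniq J ->
  {in J, forall m, (l < m)%N} -> (forall m, measurable (B m)) ->
  forall C, measurable C ->
  P (A0 `&` \bigcap_(m in [set` J]) Y m @^-1` B m
       `&` (fun w => (arrival l w, Y l w)) @^-1` C) =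
    (P A0 * \prod_(m <- J) nu m (B m) * (arrival_law l \x nu l) C)%E.
Proof.
pose k J0 B0 := fine (P A0 * \prod_(m <- J0) nu m (B0 m))%E.
have kE J0 B0 : (forall m, measurable (B0 m)) ->
  (P A0 * \prod_(m <- J0) nu m (B0 m))%E = (k J0 B0)%:E.
  move=> mB0; rewrite fineK// fin_numM//; first exact: fin_num_measure.
  elim: J0 => [|m J0 IH]; first by rewrite big_nil.
  by rewrite big_cons fin_numM//; exact: fin_num_measure.
pose upd (B0 : nat -> set R) m0 A m := if m == m0 then A else B0 m.
have updB m0 A J0 B0 : m0 \notin J0 ->
    A0 `&` \bigcap_(m in [set` m0 :: J0]) Y m @^-1` upd B0 m0 A m =
    A0 `&` \bigcap_(m in [set` J0]) Y m @^-1` B0 m `&` Y m0 @^-1` A.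
  move=> m0J; apply/seteqP; split=> [w [w0 wB]|w [[w0 wB] wA]]; split=> //.
  - split=> // m /= mJ; have := wB m; rewrite /= inE mJ orbT /upd => /(_ isT).
    by case: eqVneq => // mm; rewrite -mm mJ in m0J.
  - by have := wB m0; rewrite /= inE eqxx /upd eqxx => /(_ isT).
  - move=> m /=; rewrite inE /upd; case: eqVneq => [->//|_ /= mJ].
    exact: wB.
have updP m0 A J0 B0 : m0 \notin J0 ->
    (\prod_(m <- m0 :: J0) nu m (upd B0 m0 A m) =
     nu m0 A * \prod_(m <- J0) nu m (B0 m))%E.
  move=> m0J; rewrite big_cons /upd eqxx; congr (_ * _)%E.
  apply: eq_big_seq => m mJ; case: eqVneq => // mm.
  by rewrite -mm mJ in m0J.
have updm B0 m0 A : (forall m, measurable (B0 m)) -> measurable A ->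
    forall m, measurable (upd B0 m0 A m).
  by move=> mB0 mA m; rewrite /upd; case: ifP.
elim: l J B => [|l IHl] J B uJ lJ mB C mC; rewrite kE//.
- have nJ : 0%N \notin J by apply/negP => /lJ.
  apply: joint_law => //.
  + exact: measurable_future.
  + exact: measurable_arrival.
  + by rewrite fine_ge0// mule_ge0//; apply: prode_ge0.
  move=> A A' mA mA'.
  have [A0A|A0A] := pselect (A 0).
    have -> : arrival 0 @^-1` A = setT.
      by apply/seteqP; split=> // w _; rewrite /arrival /= big_ord0.
    rewrite setTI -updB// indep//; last 2 first.
    + by rewrite /= nJ.
    + exact: updm.
    rewrite updP// -[arrival_law 0 A]/(\d_(0 : R) A) diracE mem_set// mul1e -kE//.
    by rewrite -muleA; congr (_ * _)%E; rewrite muleC.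
  have -> : arrival 0 @^-1` A = set0.
    by apply/seteqP; split=> // w; rewrite /arrival /= big_ord0.
  by rewrite set0I setI0 measure0 -[arrival_law 0 A]/(\d_(0 : R) A) diracE memNset// mul0e mule0.
- have nJ : l.+1 \notin J by apply/negP => /lJ; rewrite ltnn.
  apply: joint_law => //.
  + exact: measurable_future.
  + exact: measurable_arrival.
  + by rewrite fine_ge0// mule_ge0//; apply: prode_ge0.
  move=> A A' mA mA'.
  have -> : arrival l.+1 @^-1` A = (fun w => (arrival l w, Y l w)) @^-1` (addp @^-1` A).
    by apply/seteqP; split=> w; rewrite /arrival /= big_ord_recr.
  rewrite (setIC (_ @^-1` (_ @^-1` _))) setIA -updB//.
  rewrite IHl//; last 4 first.
  + by rewrite /= nJ.
  + by move=> m; rewrite inE => /orP[/eqP ->//|/lJ /ltnW].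
  + exact: updm.
  + by rewrite -[X in measurable X]setTI; exact: measurable_addp.
  rewrite updP// -kE// -!muleA; congr (_ * _)%E.
  rewrite muleCA; congr (_ * _)%E.
  by rewrite muleC.
Qed.

End Renewal.
End JointLaw.

(** * Law of a single on-off process *)

Section Exponential.
Variables (R : realType) (r : R).
Hypothesis r0 : 0 < r.

Lemma exponential_prob_lt0 : exponential_prob r `]-oo, 0[ = 0%E.
Proof.
rewrite /exponential_prob integral0_eq// => x /=.
by rewrite in_itv /= => x0; rewrite lt0_exponential_pdf.
Qed.

(** The density of the exponential law is at most its rate. *)
Lemma exponential_prob_le (u v : R) : u <= v ->
  (exponential_prob r `]u, v] <= (r * (v - u))%:E)%E.
Proof.
move=> uv; rewrite /exponential_prob.
apply: (@le_trans _ _ (\int[lebesgue_measure]_(x in `]u, v]) (cst r%:E x))%E).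
  apply: ge0_le_integral => //.
  - by move=> x _; rewrite lee_fin exponential_pdf_ge0// ltW.
  - apply/measurable_EFinP; apply: measurable_funTS.
    exact: measurable_exponential_pdf.
  - move=> x _; rewrite lee_fin /=; have [x0|x0] := ltP x 0.
      by rewrite lt0_exponential_pdf// ltW.
    rewrite exponential_pdfE//; apply: ler_piMr; first exact: ltW.
    by rewrite -expR0 ler_expR mulNr oppr_le0 mulr_ge0// ltW.
rewrite integral_cst//= lebesgue_measure_itv /= lte_fin.
case: ltP => uv'; first by rewrite -EFinD -EFinM.
by rewrite mule0 lee_fin mulr_ge0 ?subr_ge0// ltW.
Qed.

End Exponential.

Section OnOffLaw.
Context {R : realType} {d : measure_display} {Omega : measurableType d}.
Variables (P : probability Omega R) (T p0 lon loff : R).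
Hypotheses (T0 : 0 < T) (p001 : 0 < p0 < 1) (lon0 : 0 < lon) (loff0 : 0 < loff).

Let rate (b : bool) := if b then lon else loff.
Let rmax := lon + loff.

Lemma rate_gt0 b : 0 < rate b. Proof. by case: b. Qed.

Lemma rate_le b : rate b <= rmax.
Proof. by rewrite /rmax /rate; have [h1 h2] := (lon0, loff0); case: b; lra. Qed.

(** Probability that an exponential variable of rate lon + loff is at most T; it
    dominates the same probability for both kinds of sojourns. *)
Definition short_prob : R := 1 - expR (- rmax * T).

Lemma short_prob_bounds : 0 <= short_prob < 1.
Proof.
rewrite /short_prob; have := expR_gt0 (- rmax * T).
have : expR (- rmax * T) <= 1.
  rewrite -expR0 ler_expR mulNr oppr_le0 mulr_ge0 ?addr_ge0 ?ltW//.
by move=> ? ?; apply/andP; split; lra.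
Qed.

(** Laws of the sojourns.  They are given as abstract probabilities so that
    several processes can share them. *)
Variable E : bool -> probability R R.
Hypothesis EE : forall b A, measurable A -> E b A = exponential_prob (rate b) A.

Lemma short_sojourn_le b : (E b `[0%R, T]%classic <= short_prob%:E)%E.
Proof.
rewrite EE// exponential_prob_itv0c// -EFinB lee_fin lerD2l lerN2 ler_expR.
by rewrite !mulNr lerN2 ler_wpM2r ?rate_le// ltW.
Qed.

Let nu b m := E (b (+) odd m).

Section Process.
Variable x : R -> Omega -> bool.
Hypothesis hx : on_off_process P T p0 lon loff x.

Let init b := [set w | x 0 w = b].

Lemma measurable_state t b : t \in `[0, T] -> measurable [set w | x t w = b].
Proof.
move=> tT; have := on_off_measurable hx tT.
case: b => //; rewrite (_ : [set w | x t w = false] = ~` [set w | x t w]).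
  exact: measurableC.
by apply/seteqP; split=> w /=; case: (x t w).
Qed.

Lemma measurable_init b : measurable (init b).
Proof. by apply: measurable_state; rewrite in_itv /= lexx ltW. Qed.

Definition init_prob (b : bool) : R := if b then p0 else 1 - p0.

Lemma init_probE b : P (init b) = (init_prob b)%:E.
Proof.
have h := on_off_init hx.
case: b; first exact: h.
have -> : init false = ~` [set w | x 0 w].
  by apply/seteqP; split=> w /=; rewrite /init /=; case: (x 0 w).
by rewrite probability_setC ?h//; exact: measurable_init true.
Qed.

Section Sojourns.
Variable S : bool -> nat -> {RV P >-> R}.
Hypothesis lawS : forall b k (A : set R), measurable A ->
  distribution P (S b k) A = exponential_prob (if b then lon else loff) A.
Hypothesis indS : mutually_independent P (on_off_source x S).

Let Y b m : {RV P >-> R} := S (b (+) odd m) m./2.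

(** For a path that starts in state b, the sojourns in order of time form a
    reindexed subfamily of the independent sources. *)
Lemma sojourns_indep b (J : seq nat) (B : nat -> set R) : uniq J ->
  (forall m, measurable (B m)) ->
  P (init b `&` \bigcap_(m in [set` J]) Y b m @^-1` B m) =
    (P (init b) * \prod_(m <- J) nu b m (B m))%E.
Proof.
move=> uJ mB.
pose g m : option (bool * nat) := Some (b (+) odd m, m./2).
(* inverse of the reindexing m -> (b (+) odd m, m./2) *)
pose pos (c : bool) (k : nat) := ((c (+) b) + k.*2)%N.
have posE m : pos (b (+) odd m) m./2 = m.
  by rewrite /pos addbC addbA addbb /= odd_double_half.
pose Ev (o : option (bool * nat)) : set Omega :=
  if o is Some (c, k) then S c k @^-1` B (pos c k) else init b.
have Evg m : Ev (g m) = Y b m @^-1` B m by rewrite /Ev /g posE.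
have gi : injective g by move=> m m' [h1 h2]; rewrite -(posE m) -(posE m') h1 h2.
have uJ' : uniq (None :: map g J).
  rewrite /= map_inj_uniq// uJ andbT; apply/negP => /mapP[m _].
  by [].
have := indS uJ' (E := Ev).
have -> : \bigcap_(i in [set` None :: map g J]) Ev i =
    init b `&` \bigcap_(m in [set` J]) Y b m @^-1` B m.
  apply/seteqP; split=> [w h|w [w0 h]].
    split; first by have := h None; apply; rewrite /= inE.
    move=> m /= mJ; have := h (g m); rewrite Evg; apply.
    by rewrite /= inE /= map_f.
  move=> o /=; rewrite inE => /orP[/eqP ->//|/mapP[m mJ ->]].
  by rewrite Evg; exact: h.
rewrite big_cons big_map => -> //; last first.
  move=> o; rewrite inE => /orP[/eqP ->|/mapP[m mJ ->]].
    by exists [set b] => //; rewrite setTI; apply/seteqP; split.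
  by rewrite /= -/(pos _ _) posE; exists (B m) => //; rewrite setTI.
congr (_ * _)%E; apply: eq_bigr => m _; rewrite Evg.
by rewrite /nu EE// -(lawS _ m./2).
Qed.

Lemma joint_sojournE b l C : measurable C ->
  P (init b `&` (fun w => (arrival (Y b) l w, Y b l w)) @^-1` C) =
    ((init_prob b)%:E * (arrival_law (nu b) l \x nu b l) C)%E.
Proof.
move=> mC.
have nilP : {in [::], forall m, (l < m)%N} by [].
have := arrival_joint (measurable_init b) (@sojourns_indep b)
  (J := [::]) (B := fun=> setT) isT nilP (fun=> measurableT) mC.
rewrite big_nil mule1 init_probE => <-; congr (P (_ `&` _)).
rewrite (_ : \bigcap_(m in _) _ = setT) ?setIT//.
by apply/seteqP; split=> // w _ m.
Qed.

(** If the l-th sojourn starts before T, then the first l sojourns are all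
    shorter than T; this has geometrically small probability. *)
Lemma short_sojourns b l :
  (P (init b `&` \bigcap_(m in [set` iota 0 l]) Y b m @^-1` `[0%R, T]%classic) <= (short_prob ^+ l)%:E)%E.
Proof.
rewrite (@sojourns_indep b _ (fun=> `[0, T]%classic)) ?iota_uniq//.
have /andP[sp0 _] := short_prob_bounds.
apply: (@le_trans _ _ (1 * \prod_(m <- iota 0 l) short_prob%:E)%E).
  apply: lee_pmul => //; first exact: prode_ge0.
    exact/probability_le1/measurable_init.
  elim: (iota 0 l) => [|m s IH]; first by rewrite !big_nil.
  rewrite !big_cons; apply: lee_pmul => //; first exact: prode_ge0.
  exact: short_sojourn_le.
rewrite mul1e -[X in (_ ^+ X)%:E](size_iota 0 l).
elim: (iota 0 l) => [|m s IH].
  by rewrite big_nil.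
rewrite big_cons /= exprS EFinM; apply: lee_pmul => //.
by apply: prode_ge0 => i _; rewrite lee_fin.
Qed.


Definition regular_path (w : Omega) :=
  [/\ forall b k, 0 <= S b k w,
      exists l, T < arrival (Y (x 0 w)) l w &
      alternates T (fun b k => S b k w) (x ^~ w)].

Hypothesis altS : {ae P, forall w, alternates T (fun b k => S b k w) (x ^~ w)}.

Lemma irregular_negligible : P.-negligible (~` [set w | regular_path w]).
Proof.
pose N2 := \bigcup_k (S true k @^-1` `]-oo, 0%R[ `|` S false k @^-1` `]-oo, 0%R[).
pose F b l := init b `&` \bigcap_(m in [set` iota 0 l]) Y b m @^-1` `[0%R, T]%classic.
pose N3 b := \bigcap_l F b l.
have mF b l : measurable (F b l).
  apply: measurable_future => //; exact: measurable_init.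
have n2 : P.-negligible N2.
  apply: negligible_bigcup => k; apply: negligibleU; apply/negligibleP;
    try (by apply: preimage_measurable => //; exact: measurable_funPT).
    have := @lawS true k `]-oo, 0%R[%classic; rewrite exponential_prob_lt0 => // h.
    exact: h.
  have := @lawS false k `]-oo, 0%R[%classic; rewrite exponential_prob_lt0 => // h.
  exact: h.
have n3 b : P.-negligible (N3 b).
  have mN3 : measurable (N3 b) by exact: bigcap_measurableType.
  apply/negligibleP => //; apply/eqP; rewrite eq_le measure_ge0 andbT.
  have /andP[sp0 sp1] := short_prob_bounds.
  have cv : ((short_prob ^+ l)%:E @[l --> \oo] --> 0%:E)%E.
    apply/cvg_EFin; first by near=> l.
    by apply: cvg_expr; rewrite ger0_norm.
  apply: (@le_trans _ _ (limn (fun l => (short_prob ^+ l)%:E))); last first.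
    by rewrite (cvg_lim _ cv).
  apply: lime_ge; first by apply/cvg_ex; exists 0%:E.
  apply: nearW => l; apply: le_trans (short_sojourns b l).
  apply: le_measure; [by rewrite inE|by rewrite inE; exact: mF|].
  by move=> w; apply.
apply: negligibleS (negligibleU altS (negligibleU n2 (negligibleU (n3 true) (n3 false)))).
move=> w /=; apply: contra_notP; rewrite !not_orP => -[/contrapT alt [nn2 [nt nf]]].
have S0 b k : 0 <= S b k w.
  rewrite leNgt; apply/negP => Sn; apply: nn2; exists k => //.
  by case: b Sn => Sn; [left|right]; rewrite /= in_itv.
split=> //.
apply: contrapT => /forallNP h.
have : N3 (x 0 w) w.
  move=> l _; split=> // m _ /=; rewrite in_itv /= S0 /=.
  have := h m.+1; rewrite /arrival big_ord_recr /= => /negP; rewrite -leNgt.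
  by apply: le_trans; rewrite lerDr sumr_ge0// => i _; exact: S0.
by case: (x 0 w).
Unshelve. all: by end_near. Qed.

(** An arrival time and the following sojourn lie in [window t] when that sojourn
    is in progress at time t. *)
Definition window (t : R) : set (R * R) := [set z | z.1 <= t < z.1 + z.2].

Lemma measurable_window t : measurable (window t).
Proof.
have -> : window t = (fst @^-1` `]-oo, t]) `&` (addp @^-1` `]t, +oo[).
  apply/seteqP; split=> z; rewrite /window /= !in_itv /= andbT /addp.
    by move=> /andP[].
  by move=> [-> ->].
apply: measurableI; rewrite -[X in measurable X]setTI.
  exact: measurable_fst.
exact: measurable_addp.
Qed.

Lemma path_state w t l : regular_path w -> t \in `[0, T] ->
  window t (arrival (Y (x 0 w)) l w, Y (x 0 w) l w) -> x t w = x 0 w (+) odd l.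
Proof.
move=> [_ _ alt] tT /= ht; apply: (alt l t tT).
by rewrite [sojourn_start _ _ l.+1]big_ord_recr.
Qed.

Lemma path_window w t : regular_path w -> 0 <= t <= T ->
  exists l, window t (arrival (Y (x 0 w)) l w, Y (x 0 w) l w).
Proof.
move=> [_ [l0 hl0] _] /andP[t0 tT].
set b := x 0 w in hl0 *.
have ex : exists l, t < arrival (Y b) l w by exists l0; exact: le_lt_trans hl0.
case: (ex_minnP ex) => -[|l]; first by rewrite /arrival big_ord0 ltNge t0.
rewrite /arrival big_ord_recr /= => h hmin; exists l; rewrite /window /= h andbT.
by rewrite leNgt; apply/negP => /hmin; rewrite ltnn.
Qed.

Lemma arrival_mono w b l k : (forall b k, 0 <= S b k w) -> (l <= k)%N ->
  arrival (Y b) l w <= arrival (Y b) k w.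
Proof.
move=> S0 lk; rewrite /arrival -!(big_mkord predT (fun m => Y b m w)).
by rewrite (big_cat_nat _ lk)//= lerDl sumr_ge0// => i _; exact: S0.
Qed.

Lemma window_inj w t b l k : (forall b k, 0 <= S b k w) ->
  window t (arrival (Y b) l w, Y b l w) -> window t (arrival (Y b) k w, Y b k w) ->
  l = k.
Proof.
move=> S0; rewrite /window /=.
have step m : arrival (Y b) m w + Y b m w = arrival (Y b) m.+1 w.
  by rewrite /arrival big_ord_recr.
rewrite !step => /andP[l1 l2] /andP[k1 k2].
apply/eqP; rewrite eqn_leq; apply/andP; split; rewrite leqNgt; apply/negP => lk.
  by have := arrival_mono b S0 lk; have := lt_le_trans k2 (arrival_mono b S0 lk); lra.
by have := lt_le_trans l2 (arrival_mono b S0 lk); lra.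
Qed.

(** Sum over the index l of the sojourn in progress at time t; that sojourn is
    spent at 1 exactly when the initial state is [~~ odd l].  Only p0 and the laws
    E enter, so that the value is the same for all edges. *)
Definition state_prob (t : R) : \bar R :=
  (\sum_(0 <= l <oo) (init_prob (~~ odd l))%:E *
     (arrival_law (nu (~~ odd l)) l \x nu (~~ odd l) l) (window t))%E.

Lemma regular_null : exists N, [/\ measurable N, P N = 0%E &
  forall w, ~ N w -> regular_path w].
Proof.
have [N [mN PN NS]] := irregular_negligible; exists N; split=> // w nN.
by apply: contrapT => h; apply: nN; exact: NS.
Qed.

Lemma measure_diff_null (A N : set Omega) : measurable A -> measurable N ->
  P N = 0%E -> P A = P (A `\` N).
Proof.
move=> mA mN PN; rewrite (measureDI P mA mN) [X in (_ + X)%E](_ : _ = 0%E) ?adde0//.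
apply/eqP; rewrite eq_le measure_ge0 andbT -PN.
by apply: le_measure; rewrite ?inE//; exact: measurableI.
Qed.

Let sojourn_event b l C := init b `&` (fun w => (arrival (Y b) l w, Y b l w)) @^-1` C.

Lemma measurable_sojourn_event b l C : measurable C -> measurable (sojourn_event b l C).
Proof.
move=> mC; apply: measurableI; first exact: measurable_init.
apply: preimage_measurable mC; apply: measurable_fun_pair.
  exact: measurable_arrival.
exact: measurable_funPT.
Qed.

Lemma state_probE t : t \in `[0, T] -> P [set w | x t w] = state_prob t.
Proof.
move=> tT; have [N [mN PN NS]] := regular_null.
pose F l := sojourn_event (~~ odd l) l (window t).
have mF l : measurable (F l) by apply: measurable_sojourn_event; exact: measurable_window.
rewrite (measure_diff_null _ mN)//; last exact: measurable_state true tT.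
have -> : [set w | x t w] `\` N = \bigcup_l (F l `\` N).
  apply/seteqP; split=> [w [xt nN]|w [l _ [[xi Fw] nN]]]; last first.
    split=> //=; rewrite /init /= in xi.
    have := @path_state w t l (NS _ nN) tT; rewrite xi => /(_ Fw) ->.
    by case: odd.
  have [l hl] : exists l, window t (arrival (Y (x 0 w)) l w, Y (x 0 w) l w).
    by apply: path_window; [exact: NS|move: tT; rewrite in_itv].
  have := path_state (NS _ nN) tT hl; rewrite xt => /esym xl.
  have xi : x 0 w = ~~ odd l by move: xl; case: (x 0 w); case: odd.
  by exists l => //; split=> //; split=> //=; rewrite -xi.
rewrite measure_semi_bigcup; last 3 first.
- by move=> l; exact: measurableD.
- apply/trivIsetP => l k _ _ lk; apply/seteqP; split=> // w [[[xi Fw] nN] [[xi' Fw'] _]].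
  move: lk; rewrite /init /= in xi xi'.
  have [S0 _ _] := NS _ nN.
  rewrite (_ : l = k) ?eqxx//; apply: (@window_inj w t (x 0 w)) => //.
    by rewrite xi.
  by rewrite xi'.
- by apply: bigcup_measurable => l _; exact: measurableD.
rewrite /state_prob; apply: eq_eseriesr => l _.
transitivity (P (F l)); first by apply/esym; exact: measure_diff_null.
by apply: joint_sojournE; exact: measurable_window.
Qed.

(** The process can start at 1 and stay there for a time longer than T. *)
Lemma state_prob_ge : forall t, t \in `[0, T] ->
  ((p0 * (1 - short_prob))%:E <= P [set w | x t w])%E.
Proof.
move=> t tT; have [N [mN PN NS]] := regular_null.
have tT' := tT; move: tT'; rewrite in_itv /= => /andP[t0 t1].
pose A := init true `&` \bigcap_(m in [set` [:: 0%N]]) Y true m @^-1` ~` `[0%R, T]%classic.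
have mA : measurable A.
  apply: measurable_future; first exact: measurable_init.
  by move=> _; exact: measurableC.
apply: (@le_trans _ _ (P A)).
  rewrite /A (@sojourns_indep true _ (fun=> ~` `[0%R, T]%classic))//; last first.
    by move=> _; exact: measurableC.
  rewrite big_cons big_nil mule1 init_probE /= EFinM; apply: lee_pmul => //.
  - by have /andP[p00 _] := p001; rewrite lee_fin ltW.
  - by have /andP[_ /ltW ?] := short_prob_bounds; rewrite lee_fin subr_ge0.
  rewrite probability_setC// EFinB leeB//; exact: short_sojourn_le.
rewrite (measure_diff_null mA mN)//.
rewrite (measure_diff_null (measurable_state true tT) mN)//.
apply: le_measure; rewrite ?inE.
- exact: measurableD.
- by apply: measurableD => //; exact: measurable_state true tT.
move=> w [[xi Aw] nN]; split=> //=; rewrite /init /= in xi.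
have rw := NS _ nN; have [S0 _ _] := rw.
have := @path_state w t 0%N rw tT; rewrite xi; apply.
rewrite /window /= /arrival big_ord0 t0 add0r /=.
have := Aw 0%N; rewrite /= inE eqxx => /(_ isT).
rewrite /Y /= in_itv /= S0 /= => /negP; rewrite -ltNge.
exact: le_lt_trans.
Qed.

Definition flip (s u : R) := [set w | exists2 t, s <= t <= u & x t w != x s w].

Definition next_arrival_in (s u : R) : set (R * R) :=
  [set z | z.1 <= s /\ s < z.1 + z.2 <= u].

Lemma measurable_next_arrival s u : measurable (next_arrival_in s u).
Proof.
have -> : next_arrival_in s u = (fst @^-1` `]-oo, s]) `&` (addp @^-1` `]s, u]).
  apply/seteqP; split=> z; rewrite /next_arrival_in /= !in_itv /= /addp.
    by move=> [-> ->].
  by move=> [-> ->].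
apply: measurableI; rewrite -[X in measurable X]setTI.
  exact: measurable_fst.
exact: measurable_addp.
Qed.

(** Given that the l-th sojourn starts before s, it ends in ]s, u] with
    probability at most rmax (u - s), by Fubini and the bound on the density. *)
Lemma sojourn_event_le b l (s u : R) : 0 <= s -> s <= u -> u <= T ->
  (P (sojourn_event b l (next_arrival_in s u)) <=
     (rmax * (u - s) * short_prob ^+ l)%:E)%E.
Proof.
move=> s0 su uT; have [N [mN PN NS]] := regular_null.
set C := next_arrival_in s u.
have mC : measurable C by exact: measurable_next_arrival.
have rm0 : 0 <= rmax * (u - s).
  by rewrite mulr_ge0 ?subr_ge0// /rmax addr_ge0// ltW.
have mB : measurable (`]-oo, s]%classic : set R) by [].
have lawC : ((arrival_law (nu b) l \x nu b l) C <=
    (rmax * (u - s))%:E * arrival_law (nu b) l `]-oo, s]%classic)%E.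
  rewrite /product_measure1.
  apply: (@le_trans _ _ (\int[arrival_law (nu b) l]_y
      ((rmax * (u - s))%:E * (\1_(`]-oo, s]%classic) y)%:E))%E).
    apply: ge0_le_integral => //.
    - exact: measurable_fun_xsection.
    - apply/measurable_EFinP; apply: measurable_funM => //; exact: measurable_indic.
    move=> y _ /=; rewrite indicE.
    have [ys|sy] := leP y s.
      rewrite mem_set /=; last by rewrite in_itv.
      rewrite mule1 (_ : xsection C y = `]s - y, u - y]%classic); last first.
        apply/seteqP; split=> z.
          move=> /set_mem [/= _ /andP[h1 h2]]; rewrite in_itv /=.
          by apply/andP; split; lra.
        rewrite /= in_itv /= => /andP[h1 h2]; apply/mem_set; split=> //=.
        by apply/andP; split; lra.
      rewrite EE//; apply: le_trans (exponential_prob_le (rate_gt0 _) _) _; first lra.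
      have -> : u - y - (s - y) = u - s by ring.
      by rewrite lee_fin ler_wpM2r ?subr_ge0// rate_le.
    rewrite (_ : xsection C y = set0) ?measure0.
      by rewrite mule_ge0// lee_fin.
    apply/seteqP; split=> // z /set_mem [/= h _].
    by move: sy; rewrite ltNge h.
  rewrite ge0_integralZl//; last by apply/measurable_EFinP; exact: measurable_indic.
  by rewrite integral_indic// setIT.
rewrite joint_sojournE//.
have i0 : (0 <= (init_prob b)%:E)%E by rewrite -init_probE.
apply: le_trans (lee_wpmul2l i0 lawC) _.
rewrite muleCA [leRHS](EFinM (rmax * (u - s))); apply: lee_wpmul2l; first by rewrite lee_fin.
have -> : ((init_prob b)%:E * arrival_law (nu b) l `]-oo, s]%classic =
   P (sojourn_event b l (`]-oo, s]%classic `*` setT)))%E.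
  rewrite joint_sojournE; last exact: measurableX.
  by rewrite product_measure1E// [X in (_ * (_ * X))%E]probability_setT mule1.
apply: le_trans (short_sojourns b l).
have mE : measurable (sojourn_event b l (`]-oo, s]%classic `*` setT)).
  by apply: measurable_sojourn_event; exact: measurableX.
have mF : measurable (init b `&`
   \bigcap_(m in [set` iota 0 l]) Y b m @^-1` `[0%R, T]%classic).
  by apply: measurable_future => //; exact: measurable_init.
rewrite (measure_diff_null mE mN)// (measure_diff_null mF mN)//.
apply: le_measure; rewrite ?inE; [exact: measurableD|exact: measurableD|].
move=> w [[xi [/= + _]] nN]; rewrite in_itv /= => ws; split=> //; split=> // m /=.
have [S0 _ _] := NS _ nN.
rewrite mem_iota add0n /= in_itv /= => ml; rewrite S0 /=.
apply: le_trans uT; apply: le_trans su; apply: le_trans ws.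
apply: le_trans (arrival_mono b S0 ml).
by rewrite /arrival big_ord_recr /= lerDr sumr_ge0// => i _; exact: S0.
Qed.

Definition flip_const : R := 2 * rmax / (1 - short_prob).

(** A change of state in ]s, u] is an end of the sojourn in progress at time s;
    the bounds over its index l form a geometric series. *)
Lemma flip_le (s u : R) : 0 <= s -> s <= u -> u <= T -> measurable (flip s u) ->
  (P (flip s u) <= (flip_const * (u - s))%:E)%E.
Proof.
move=> s0 su uT mflip; have [N [mN PN NS]] := regular_null.
pose F b l := sojourn_event b l (next_arrival_in s u).
have mF b l : measurable (F b l).
  by apply: measurable_sojourn_event; exact: measurable_next_arrival.
have mU b : measurable (\bigcup_l F b l) by exact: bigcup_measurable.
have rm0 : 0 <= rmax * (u - s).
  by rewrite mulr_ge0 ?subr_ge0// /rmax addr_ge0// ltW.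
have /andP[sp0 sp1] := short_prob_bounds.
have PU b : (P (\bigcup_l F b l) <= (rmax * (u - s) * (1 - short_prob)^-1)%:E)%E.
  apply: (@le_trans _ _ (\sum_(0 <= l <oo) P (F b l))%E).
    exact: measure_sigma_subadditive.
  apply: (@le_trans _ _ (\sum_(0 <= l <oo) (rmax * (u - s) * short_prob ^+ l)%:E)%E).
    apply: lee_nneseries => l _ //; exact: sojourn_event_le.
  have cv : series (geometric (rmax * (u - s)) short_prob) @ \oo -->
      rmax * (u - s) * (1 - short_prob)^-1.
    by apply: cvg_geometric_series; rewrite ger0_norm.
  have cvE : ((\sum_(0 <= l < n) (rmax * (u - s) * short_prob ^+ l)%:E)%E
      @[n --> \oo] --> (rmax * (u - s) * (1 - short_prob)^-1)%:E).
    under eq_cvg do rewrite sumEFin.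
    by apply/cvg_EFin => //; near=> n.
  by rewrite (cvg_lim _ cvE).
rewrite (measure_diff_null mflip mN)//.
apply: (@le_trans _ _ (P ((\bigcup_l F true l) `|` (\bigcup_l F false l)))).
  apply: le_measure; rewrite ?inE; [exact: measurableD|exact: measurableU|].
  move=> w [[t /andP[st tu] xts] nN].
  have rw := NS _ nN.
  have sT : 0 <= s <= T by rewrite s0 (le_trans su).
  have [l hl] := path_window rw sT.
  have : F (x 0 w) l w.
    split=> //=; move/andP : (hl) => /= [h1 h2]; split=> //; rewrite h2 /=.
    rewrite leNgt; apply/negP => h3.
    have tT : t \in `[0, T] by rewrite in_itv /=; apply/andP; split; lra.
    have sT' : s \in `[0, T] by rewrite in_itv.
    have ht : window t (arrival (Y (x 0 w)) l w, Y (x 0 w) l w).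
      by rewrite /window /= (le_trans h1 st) (le_lt_trans tu h3).
    by move: xts; rewrite (path_state rw sT' hl) (path_state rw tT ht) eqxx.
  by case: (x 0 w) => h; [left|right]; exists l.
apply: le_trans (measureU2 _ _ _) _ => //.
apply: le_trans (leeD (PU true) (PU false)) _.
rewrite -EFinD lee_fin /flip_const le_eqVlt; apply/orP; left; apply/eqP.
by field; lra.
Unshelve. all: by end_near. Qed.

End Sojourns.
End Process.
End OnOffLaw.

(** * Changes of state as events of the process *)

Section FlipEvents.
Context {R : realType} {d : measure_display} {Omega : measurableType d}.
Variables (T : R) (x : R -> Omega -> bool).

Let G := [set [set w | x t w] | t in `[0, T]%classic].

Lemma process_event_measurable A :
  (forall t, t \in `[0, T] -> measurable [set w | x t w]) ->
  process_sigma_algebra T x A -> measurable A.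
Proof.
move=> xm; move: A; apply: smallest_sub.
  exact: sigma_algebra_measurable.
by move=> _ [t tT <-]; apply: xm.
Qed.

(** Below, membership in the sigma-algebra of the process is measurability for
    the generated measurable structure, which gives access to its closure
    properties. *)
Lemma process_state t : t \in `[0, T] ->
  @measurable _ (g_sigma_algebraType G) [set w | x t w].
Proof. by move=> tT; apply: sub_sigma_algebra; exists t. Qed.

Lemma process_neq s t : s \in `[0, T] -> t \in `[0, T] ->
  @measurable _ (g_sigma_algebraType G) [set w | x t w != x s w].
Proof.
move=> sT tT.
rewrite (_ : [set w | _] = ([set w | x t w] `\` [set w | x s w]) `|`
   ([set w | x s w] `\` [set w | x t w])).
  by apply: measurableU; apply: measurableD; exact: process_state.
apply/seteqP; split=> w /=; case: (x t w); case: (x s w) => //=; first by left.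
  by right.
all: by case=> -[].
Qed.

Lemma path_right_constant w t u :
  cadlag T (fun t => (x t w)%:R : R) -> 0 <= t -> t < u -> u <= T ->
  exists q : rat, t < ratr q < u /\ x (ratr q) w = x t w.
Proof.
move=> [+ _] t0 tu uT.
have tT : t \in `[0, T[ by rewrite in_itv /= t0 (lt_le_trans tu).
move=> /(_ t tT) /cvgrPdist_lt /(_ 1 ltr01).
case/nbhs_ballP => e /= e0 he.
have : t < Num.min u (t + e) by rewrite lt_min tu ltrDl.
move=> /rat_in_itvoo[q]; rewrite in_itv /= lt_min => /and3P[tq qu qe].
exists q; rewrite tq qu; split=> //.
have te : `|t - ratr q| < e by rewrite distrC gtr0_norm; lra.
have := he (ratr q) te tq; rewrite /= ltr_norml.
by case: (x t w); case: (x (ratr q) w) => //= /andP[]; lra.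
Qed.

(** By right continuity, a change of state is visible at a rational time or at the
    right endpoint u, so the event is a countable union. *)
Lemma flip_process_event s u :
  (forall w, cadlag T (fun t => (x t w)%:R : R)) ->
  0 <= s -> s <= u -> u <= T -> process_sigma_algebra T x (flip x s u).
Proof.
move=> xc s0 su uT.
have sT : s \in `[0, T] by rewrite in_itv /= s0 (le_trans su).
have uT' : u \in `[0, T] by rewrite in_itv /= uT (le_trans s0).
pose F (q : rat) : set (g_sigma_algebraType G) :=
  if s <= ratr q <= u then [set w | x (ratr q) w != x s w] else set0.
change (@measurable _ (g_sigma_algebraType G) (flip x s u)).
have -> : flip x s u = [set w | x u w != x s w] `|` \bigcup_q F q.
  apply/seteqP; split=> [w [t /andP[st tu] xts]|w [xus|[q _]]]; last 2 first.
  - by exists u; rewrite // su lexx.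
  - by rewrite /F; case: ifP => // squ xqs; exists (ratr q).
  have [tu'|tu'] := eqVneq t u; first by left; rewrite /= -tu'.
  have [q [/andP[tq qu] xq]] : exists q : rat, t < ratr q < u /\ x (ratr q) w = x t w.
    by apply: path_right_constant => //; [exact: le_trans st|rewrite lt_neqAle tu' tu].
  right; exists q => //; rewrite /F.
  by rewrite (le_trans st (ltW tq)) (ltW qu) /= xq.
apply: measurableU; first exact: process_neq.
apply: countable_bigcupT_measurable => [|q].
  by apply/countable_bijP; exists setT; exact: card_rat.
rewrite /F; case: ifP => // /andP[sq qu]; apply: process_neq => //.
by rewrite in_itv /= (le_trans s0 sq) (le_trans qu).
Qed.

End FlipEvents.

(** The sojourn laws of one process serve as the common E, which makes the law at
    time t and the constants independent of the process. *)
Lemma on_off_uniform (R : realType) (d : measure_display) (Omega : measurableType d)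
    (P : probability Omega R) (T p0 lon loff : R) :
  0 < T -> 0 < p0 < 1 -> 0 < lon -> 0 < loff ->
  (exists x, on_off_process P T p0 lon loff x) ->
  exists p : R -> R, exists c C : R, [/\ 0 < c, 0 <= C &
    forall x, on_off_process P T p0 lon loff x ->
      (forall t, t \in `[0, T] -> P [set w | x t w] = (p t)%:E /\ c <= p t) /\
      (forall s u, 0 <= s -> s <= u -> u <= T ->
        (P (flip x s u) <= (C * (u - s))%:E)%E)].
Proof.
move=> T0 p001 lon0 loff0 [x0 hx0].
have [S0 [law0 _ _]] := on_off_sojourns hx0.
pose E b : probability R R := distribution P (S0 b 0%N).
have EE b A : measurable A -> E b A = exponential_prob (if b then lon else loff) A.
  exact: law0.
have /andP[sp0 sp1] := @short_prob_bounds R T lon loff T0 lon0 loff0.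
have /andP[p00 _] := p001.
exists (fun t => fine (state_prob p0 E t)), (p0 * (1 - short_prob T lon loff)),
  (flip_const T lon loff); split.
- by rewrite mulr_gt0// subr_gt0.
- apply: divr_ge0; last by rewrite subr_ge0 ltW.
  by apply: mulr_ge0 => //; apply: addr_ge0; exact: ltW.
move=> x hx; have [S [lawS indS altS]] := on_off_sojourns hx; split.
  move=> t tT.
  have mt := on_off_measurable hx tT.
  have PtE := state_probE T0 lon0 loff0 EE hx lawS indS altS tT.
  have Ptge := state_prob_ge T0 p001 lon0 loff0 EE hx lawS indS altS tT.
  have fin : P [set w | x t w] \is a fin_num by exact: fin_num_measure.
  by rewrite -PtE fineK//; split=> //; rewrite -lee_fin fineK.
move=> s u s0 su uT.
apply: (flip_le T0 lon0 loff0 EE hx lawS indS altS) => //.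
apply: (@process_event_measurable _ _ _ T x); first exact: on_off_measurable hx.
by apply: flip_process_event => //; exact: on_off_cadlag hx.
Qed.

(** * Snapshots of the dynamic graph *)

(** A random variable X with values in a finite type: probabilities and
    expectations reduce to finite sums. *)
Section FiniteLaw.
Context {R : realType} {d : measure_display} {Omega : measurableType d}.
Variables (P : probability Omega R) (I : finType) (p : R).
Variable X : Omega -> {ffun I -> bool}.
Hypothesis mX : forall v, measurable (X @^-1` [set v]).
Hypothesis lawX : forall v, P (X @^-1` [set v]) = (weight p v)%:E.

Lemma measurable_finite_fun (B : pred {ffun I -> bool}) :
  measurable [set w | B (X w)].
Proof.
have -> : [set w | B (X w)] = \bigcup_(v in [set v | B v]) (X @^-1` [set v]).
  by apply/seteqP; split=> [w Bw|w [v Bv /= ->]] //; exists (X w).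
by apply: fin_bigcup_measurable => // v _; exact: mX.
Qed.

Lemma measurable_finite_map (f : {ffun I -> bool} -> R) :
  measurable_fun setT (fun w => f (X w)).
Proof.
move=> _ A mA; rewrite setTI.
have -> : (fun w => f (X w)) @^-1` A = \bigcup_(v in [set v | A (f v)]) (X @^-1` [set v]).
  by apply/seteqP; split=> [w Bw|w [v Bv /= ->]] //; exists (X w).
by apply: fin_bigcup_measurable => // v _; exact: mX.
Qed.

Lemma expectation_finite (f : {ffun I -> bool} -> R) :
  'E_P[fun w => f (X w)]%E = (mean p f)%:E.
Proof.
rewrite unlock.
have -> : (\int[P]_w (f (X w))%:E = \int[P]_w (\sum_(v : {ffun I -> bool})
    (fun v w => (f v)%:E * (\1_(X @^-1` [set v]) w)%:E) v w))%E.
  apply: eq_integral => w _; rewrite (bigD1 (X w))//= indicE mem_set// mule1.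
  rewrite big1 ?adde0// => v vX; rewrite indicE memNset ?mule0// => /esym/eqP.
  by rewrite (negPf vX).
have int1 v : P.-integrable setT (fun w => (\1_(X @^-1` [set v]) w)%:E).
  by apply: integrable_indic => //; exact: fin_num_measure.
rewrite integral_sum//; last first.
  by move=> v; apply: integrableZl.
rewrite /mean -sumEFin; apply: eq_bigr => v _.
rewrite integralZl// integral_indic// setIT EFinM muleC; congr (_ * _)%E.
exact: lawX.
Qed.

Lemma prob_finite (B : pred {ffun I -> bool}) : P [set w | B (X w)] = (prob p B)%:E.
Proof.
rewrite -expectation_finite -(expectation_indic P (measurable_finite_fun B)).
congr expectation; apply/funext => w; rewrite indicE.
by case: (boolP (B (X w))) => h; [rewrite mem_set|rewrite memNset//; apply/negP].
Qed.

End FiniteLaw.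

Section Snapshot.
Context {R : realType} {d : measure_display} {Omega : measurableType d}.
Variables (P : probability Omega R) (T p0 lon loff : R) (n : nat).
Variable a : 'I_n -> 'I_n -> R -> Omega -> bool.
Hypothesis T0 : 0 < T.
Hypothesis ha : dynamic_ER P T p0 lon loff a.

Definition snapshot (t : R) (w : Omega) : {ffun edges n -> bool} :=
  [ffun e => a (val e).1 (val e).2 t w].

Definition edge_process (e : edges n) := a (val e).1 (val e).2.

Lemma edge_on_off e : on_off_process P T p0 lon loff (edge_process e).
Proof. by apply: (ER_on_off ha); exact: (valP e). Qed.

Lemma snapshot_edge t w i j : t \in `[0, T] -> snapshot t w (edge i j) = a i j t w.
Proof.
move=> tT; rewrite ffunE /= /sort_pair; case: ifP => //= _.
exact: (ER_sym ha).
Qed.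

Lemma measurable_snapshot t v : t \in `[0, T] -> measurable (snapshot t @^-1` [set v]).
Proof.
move=> tT.
have -> : snapshot t @^-1` [set v] =
    \bigcap_(e in [set` enum {: edges n}]) [set w | edge_process e t w = v e].
  apply/seteqP; split=> [w <- e _ /=|w h]; first by rewrite ffunE.
  by apply/ffunP => e; rewrite ffunE; apply: h; rewrite /= mem_enum.
apply: fin_bigcap_measurable => // e _.
have me := on_off_measurable (edge_on_off e) tT.
case: (v e) => //; rewrite (_ : [set w | _ = false] = ~` [set w | edge_process e t w]).
  exact: measurableC.
by apply/seteqP; split=> w /=; case: edge_process.
Qed.

Lemma snapshot_law t p v : t \in `[0, T] ->
  (forall e, P [set w | edge_process e t w] = p%:E) ->
  P (snapshot t @^-1` [set v]) = (weight p v)%:E.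
Proof.
move=> tT pe.
have := ER_indep ha (J := enum {: edges n}) (E := fun e => [set w | edge_process e t w = v e]).
have -> : snapshot t @^-1` [set v] =
    \bigcap_(e in [set` enum {: edges n}]) [set w | edge_process e t w = v e].
  apply/seteqP; split=> [w <- e _ /=|w h]; first by rewrite ffunE.
  by apply/ffunP => e; rewrite ffunE; apply: h; rewrite /= mem_enum.
move=> -> //; last 2 first.
- exact: enum_uniq.
- move=> e _.
  pose G := [set [set w | edge_process e t w] | t in `[0, T]%classic].
  change (@measurable _ (g_sigma_algebraType G) [set w | edge_process e t w = v e]).
  have mG : @measurable _ (g_sigma_algebraType G) [set w | edge_process e t w].
    by apply: sub_sigma_algebra; exists t.
  case: (v e) => //; rewrite (_ : [set w | _ = false] = ~` [set w | edge_process e t w]).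
    exact: measurableC.
  by apply/seteqP; split=> w /=; case: edge_process.
rewrite big_enum /= /weight -prodEFin; apply: eq_bigr => e _.
case: (v e); first exact: pe.
rewrite (_ : [set w | _ = false] = ~` [set w | edge_process e t w]).
  have me := on_off_measurable (edge_on_off e) tT.
  by rewrite probability_setC// pe EFinB.
by apply/seteqP; split=> w /=; case: edge_process.
Qed.

End Snapshot.

(** * Remainder of the expansion, and control of all times *)

Section Residual.
Variables (R : realType) (n : nat).
Hypothesis n0 : (0 < n)%N.
Local Notation V := {ffun edges n -> bool}.
Implicit Types (p c s l K : R) (v : V).

Definition adj v : 'M[R]_n := \matrix_(i, j) (v (edge i j))%:R.

Lemma adjE p v i j : adj v i j = p + noise p v i j.
Proof. by rewrite mxE /noise /centered; ring. Qed.

Lemma adj_ge0 v i j : 0 <= adj v i j.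
Proof. by rewrite mxE. Qed.

Lemma adj_sym v : (adj v)^T = adj v.
Proof. by apply/matrixP => i j; rewrite !mxE edgeC. Qed.

(** The linear statistic has mean zero ([mean_sum_walks]), so that mu minus its
    mean minus the linear statistic is this quantity minus its mean. *)
Definition residual p v : R := principal_eigenvalue (adj v)
  - (n%:R * p + (1 - p) + (\sum_i walks (noise p v) 1 i) / n%:R).

(** A crude bound, to be multiplied by a very small probability. *)
Lemma residual_bound p v : 0 <= p <= 1 -> `|residual p v| <= 5 * n%:R.
Proof.
move=> p01; have /andP[h0 h1] := p01.
have n1 : 1 <= n%:R :> R by rewrite ler1n.
have e1 : `|principal_eigenvalue (adj v)| <= 2 * n%:R.
  rewrite -[principal_eigenvalue _]subr0.
  apply: (@principal_eigenvalue_approx R n (adj v) (fun=> 1)) => //.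
  - exact: adj_sym.
  - by move=> i j; exact: adj_ge0.
  - by move=> _; lra.
  move=> i; rewrite mul0r subr0; apply: le_trans (ler_norm_sum _ _ _) _.
  apply: (@le_trans _ _ (\sum_(j < n) 1)); last by rewrite sumr_const card_ord.
  by apply: ler_sum => j _; rewrite mulr1 mxE; case: (v _); rewrite ?normr1 ?normr0.
have e2 : `|(\sum_i walks (noise p v) 1 i) / n%:R| <= n%:R.
  rewrite normrM normfV (ger0_norm (ler0n _ _)) ler_pdivrMr; last lra.
  apply: le_trans (ler_norm_sum _ _ _) _.
  apply: (@le_trans _ _ (\sum_(i < n) n%:R)); last first.
    by rewrite sumr_const card_ord -[leLHS]mulr_natl.
  apply: ler_sum => i _; rewrite -[leRHS]mulr1; apply: mulfv_bound.
    exact: noise_le1.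
  by move=> j; rewrite normr1.
have e3 : `|n%:R * p + (1 - p)| <= 2 * n%:R :> R.
  have : n%:R * p <= n%:R :> R by rewrite ler_piMr.
  have : 0 <= n%:R * p :> R by rewrite mulr_ge0.
  by move=> ? ?; rewrite ger0_norm; lra.
rewrite /residual; apply: le_trans (ler_normB _ _) _.
have := ler_normD (n%:R * p + (1 - p)) ((\sum_i walks (noise p v) 1 i) / n%:R).
by lra.
Qed.

Lemma residual_small p s l K c v : 0 < s -> s ^+ 2 = n%:R -> 1 <= l -> 1 <= K ->
  0 < c -> c <= 1 -> c <= p -> 8 * K * l <= c * s ->
  regular (noise p v) p s l K ->
  `|residual p v| <= (15 * K ^+ 2 / c ^+ 2) * (l ^+ 3 / s).
Proof.
move=> s0 sn l1 K1 c0 c1 cp small reg; rewrite /residual -sn.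
apply: principal_eigenvalue_expansion => //.
- exact: noiseC.
- by move=> i j; exact: adjE.
- by move=> i j; exact: adj_ge0.
Qed.

Lemma mean_sum_walks p : 0 <= p <= 1 ->
  mean p (fun v => (\sum_i walks (noise p v) 1 i) / n%:R) = 0.
Proof.
move=> p01.
have -> : (fun v => (\sum_i walks (noise p v) 1 i) / n%:R) =
   (fun v => n%:R^-1 * (\sum_i \sum_j noise p v i j)).
  apply/funext => v; rewrite mulrC; congr (_ * _).
  by apply: eq_bigr => i _; rewrite walks1.
rewrite meanZ mean_sum big1 ?mulr0// => i _.
by rewrite mean_sum big1// => j _; exact: mean_centered.
Qed.

Lemma mean_principal p : 0 <= p <= 1 ->
  mean p (fun v => principal_eigenvalue (adj v)) =
    mean p (residual p) + (n%:R * p + (1 - p)).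
Proof.
move=> p01; have h := mean_sum_walks p01.
have -> : (fun v => principal_eigenvalue (adj v)) =
  (fun v => residual p v + ((n%:R * p + (1 - p)) +
    (\sum_i walks (noise p v) 1 i) / n%:R)).
  by apply/funext => v; rewrite /residual subrK.
by rewrite meanD; congr (_ + _); rewrite meanD h addr0; exact: mean_cst.
Qed.

Lemma mean_residual p (B : pred V) e : 0 <= p <= 1 -> 0 <= e ->
  (forall v, ~~ B v -> `|residual p v| <= e) ->
  `|mean p (residual p)| <= e + 5 * n%:R * prob p B.
Proof.
move=> p01 e0 Be.
apply: (@le_trans _ _ (mean p (fun v => `|residual p v|))).
  apply: le_trans (ler_norm_sum _ _ _) _; apply: ler_sum => v _.
  by rewrite normrM ger0_norm// weight_ge0.
rewrite -[X in X + _](@mean_cst _ (edges n) p) -meanZ -meanD.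
apply: ler_mean => // v; case: (boolP (B v)) => [_|/Be] /=.
  by rewrite mulr1; apply: le_trans (residual_bound v p01) _; rewrite lerDr.
by rewrite mulr0 addr0.
Qed.

End Residual.

Section UnionBound.
Context {R : realType} {d : measure_display} {Omega : measurableType d}.
Variable P : probability Omega R.

Lemma measurable_bigU (I : Type) (s : seq I) (F : I -> set Omega) :
  (forall i, measurable (F i)) -> measurable (\big[setU/set0]_(i <- s) F i).
Proof. by move=> mF; elim/big_ind: _ => //; exact: measurableU. Qed.

Lemma union_bound (I : Type) (s : seq I) (F : I -> set Omega) (b : R) :
  (forall i, measurable (F i)) -> (forall i, (P (F i) <= b%:E)%E) ->
  (P (\big[setU/set0]_(i <- s) F i) <= ((size s)%:R * b)%:E)%E.
Proof.
move=> mF Fb; elim: s => [|i s IHs]; first by rewrite big_nil measure0 mul0r.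
rewrite big_cons /= -natr1 mulrDl mul1r addrC EFinD.
apply: le_trans (measureU2 _ _ _) (leeD (Fb i) IHs) => //.
exact: measurable_bigU.
Qed.

End UnionBound.

(** The interval [0, T] is cut into M cells of length T / M. *)
Section Cells.
Context {R : realType} {d : measure_display} {Omega : measurableType d}.
Variables (P : probability Omega R) (T p0 lon loff : R) (n : nat).
Variable a : 'I_n -> 'I_n -> R -> Omega -> bool.
Hypotheses (T0 : 0 < T) (n0 : (0 < n)%N).
Hypothesis ha : dynamic_ER P T p0 lon loff a.
Variables (p : R -> R) (c C : R).
Hypotheses (c0 : 0 < c) (C0 : 0 <= C).
Hypothesis pE : forall e t, t \in `[0, T] ->
  P [set w | edge_process a e t w] = (p t)%:E /\ c <= p t.
Hypothesis flipE : forall e s u, 0 <= s -> s <= u -> u <= T ->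
  (P (flip (edge_process a e) s u) <= (C * (u - s))%:E)%E.

Let e0 : edges n := edge (Ordinal n0) (Ordinal n0).

Lemma p_bounds t : t \in `[0, T] -> c <= p t <= 1.
Proof.
move=> tT; have [h1 ->] /= := pE e0 tT.
rewrite -lee_fin -h1; apply: probability_le1.
exact: (on_off_measurable (edge_on_off ha e0) tT).
Qed.

Lemma measurable_flip e s u : 0 <= s -> s <= u -> u <= T ->
  measurable (flip (edge_process a e) s u).
Proof.
move=> s0 su uT; apply: (@process_event_measurable _ _ _ T (edge_process a e)).
  by move=> t tT; exact: (on_off_measurable (edge_on_off ha e) tT).
apply: flip_process_event => //.
by move=> w; exact: (on_off_cadlag (edge_on_off ha e)).
Qed.

(** The events that the edge is present at times s and t differ only if it changes
    state in between. *)
Lemma p_lipschitz s t : 0 <= s -> s <= t -> t <= T -> `|p t - p s| <= C * (t - s).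
Proof.
move=> s0 st tT.
have sT : s \in `[0, T] by rewrite in_itv /= s0 (le_trans st).
have tT' : t \in `[0, T] by rewrite in_itv /= tT (le_trans s0).
pose A u := [set w | edge_process a e0 u w].
have mA u : u \in `[0, T] -> measurable (A u).
  by move=> uT; exact: (on_off_measurable (edge_on_off ha e0) uT).
pose F := flip (edge_process a e0) s t.
have mF : measurable F by exact: measurable_flip.
have key u v : u \in `[0, T] -> v \in `[0, T] -> A u `<=` A v `|` F ->
    p u <= p v + C * (t - s).
  move=> uT vT uv; rewrite -lee_fin EFinD.
  have [<- _] := pE e0 uT; have [<- _] := pE e0 vT.
  apply: le_trans (_ : (P (A v `|` F) <= _)%E); last first.
    by apply: le_trans (measureU2 _ _ _) _; [exact: mA|exact: mF|rewrite leeD2l// flipE].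
  by apply: le_measure; rewrite ?inE//; [exact: mA|apply: measurableU => //; exact: mA].
have h1 : p t <= p s + C * (t - s).
  apply: key => // w Aw; case: (boolP (edge_process a e0 s w)) => sw; [by left|right].
  by exists t; [rewrite st lexx|rewrite /A /= in Aw; rewrite Aw (negPf sw)].
have h2 : p s <= p t + C * (t - s).
  apply: key => // w Aw; case: (boolP (edge_process a e0 t w)) => tw; [by left|right].
  by exists t; [rewrite st lexx|rewrite /A /= in Aw; rewrite Aw (negPf tw)].
by rewrite ler_norml; lra.
Qed.

Definition pair_flip s u (ef : edges n * edges n) : set Omega :=
  if ef.1 != ef.2 then
    flip (edge_process a ef.1) s u `&` flip (edge_process a ef.2) s u
  else set0.

Definition double_flip s u : set Omega :=
  \big[setU/set0]_(ef <- enum {: edges n * edges n}) pair_flip s u ef.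

Lemma double_flipP s u e f w : e != f -> flip (edge_process a e) s u w ->
  flip (edge_process a f) s u w -> double_flip s u w.
Proof.
move=> ef we wf; rewrite /double_flip -bigcup_seq.
by exists (e, f); [rewrite /= mem_enum|rewrite /pair_flip ef].
Qed.

Lemma measurable_pair_flip s u ef : 0 <= s -> s <= u -> u <= T ->
  measurable (pair_flip s u ef).
Proof.
move=> s0 su uT; rewrite /pair_flip; case: ifP => // _.
by apply: measurableI; exact: measurable_flip.
Qed.

Lemma measurable_double_flip s u : 0 <= s -> s <= u -> u <= T ->
  measurable (double_flip s u).
Proof. by move=> *; apply: measurable_bigU => ef; exact: measurable_pair_flip. Qed.

(** Distinct edges are independent, and there are at most n^4 pairs. *)
Lemma double_flip_le s u : 0 <= s -> s <= u -> u <= T ->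
  (P (double_flip s u) <= (n%:R ^+ 4 * (C * (u - s)) ^+ 2)%:E)%E.
Proof.
move=> s0 su uT.
have q0 : 0 <= (C * (u - s)) ^+ 2 by exact: sqr_ge0.
have PF ef : (P (pair_flip s u ef) <= ((C * (u - s)) ^+ 2)%:E)%E.
  rewrite /pair_flip; case: ifP => [ne|_]; last by rewrite measure0 lee_fin.
  have := ER_indep ha (J := [:: ef.1; ef.2]) (E := fun e => flip (edge_process a e) s u).
  rewrite !big_cons big_nil mule1 => h.
  have -> : flip (edge_process a ef.1) s u `&` flip (edge_process a ef.2) s u =
    \bigcap_(i in [set` [:: ef.1; ef.2]]) flip (edge_process a i) s u.
    apply/seteqP; split=> [w [w1 w2] e /=|w h'].
      by rewrite !inE => /orP[/eqP ->|/eqP ->].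
    by split; apply: h'; rewrite /= !inE eqxx ?orbT.
  rewrite h; last 2 first.
  - by rewrite /= inE ne.
  - move=> e _; apply: flip_process_event => // w.
    exact: (on_off_cadlag (edge_on_off ha e)).
  rewrite expr2 EFinM; apply: lee_pmul => //; exact: flipE.
apply: le_trans (union_bound _ _ PF) _.
  by move=> ef; exact: measurable_pair_flip.
rewrite lee_fin; apply: ler_wpM2r => //.
rewrite -cardE card_prod natrM (_ : n%:R ^+ 4 = (n * n)%:R * (n * n)%:R); last first.
  by rewrite natrM; ring.
by apply: ler_pM => //; rewrite ler_nat card_edges.
Qed.

Variables (M : nat) (s l : R).
Hypotheses (M0 : (0 < M)%N) (s1 : 1 <= s) (sn : s ^+ 2 = n%:R) (l1 : 1 <= l).
Hypothesis Mbig : C * (T / M%:R) <= (n%:R ^+ 2)^-1.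

Let grid (k : nat) : R := k%:R * (T / M%:R).

Lemma grid_bounds k : (k < M)%N -> [/\ 0 <= grid k, grid k <= grid k.+1 & grid k.+1 <= T].
Proof.
move=> kM; have TM : 0 <= T / M%:R by rewrite divr_ge0// ltW.
split; rewrite /grid; first by rewrite mulr_ge0.
  by rewrite ler_wpM2r// ler_nat.
rewrite mulrCA -[leRHS]mulr1; apply: ler_wpM2l; first exact: ltW.
by rewrite ler_pdivrMr ?ltr0n// mul1r ler_nat.
Qed.

Lemma grid_step k : grid k.+1 - grid k = T / M%:R.
Proof. by rewrite /grid -natr1; ring. Qed.

Lemma grid_cell t : 0 <= t <= T -> exists2 k, (k < M)%N & grid k <= t <= grid k.+1.
Proof.
move=> /andP[t0 tT].
have TM : 0 < T / M%:R by rewrite divr_gt0// ltr0n.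
have gM : grid M = T by rewrite /grid mulrC divfK// pnatr_eq0 -lt0n.
have ex : exists k, (0 < k)%N && (t <= grid k) by exists M; rewrite M0 gM.
case: (ex_minnP ex) => -[//|k] /= tk hmin; exists k; last first.
  rewrite tk andbT; case: k tk hmin => [|k] _ hmin; first by rewrite /grid mul0r.
  by rewrite leNgt; apply/negP => /ltW h; have := hmin k.+1; rewrite h ltnn => /(_ isT).
by have := hmin M; rewrite M0 gM tT; exact.
Qed.

Definition bad_cell (k : nat) : set Omega :=
  if (k < M)%N then
    [set w | bad (p (grid k)) s l (snapshot a (grid k) w)]
      `|` double_flip (grid k) (grid k.+1)
  else set0.

Definition bad_event : set Omega := \big[setU/set0]_(k <- iota 0 M) bad_cell k.

Lemma grid_in k : (k < M)%N -> grid k \in `[0, T].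
Proof.
move=> /grid_bounds[h1 h2 h3]; rewrite in_itv /= h1; exact: le_trans h3.
Qed.

Lemma edge_law t : t \in `[0, T] ->
  forall e, P [set w | edge_process a e t w] = (p t)%:E.
Proof. by move=> tT e; have [] := pE e tT. Qed.

Lemma p_unit t : t \in `[0, T] -> 0 <= p t <= 1.
Proof. by move=> /p_bounds /andP[h ->]; rewrite (le_trans (ltW c0) h). Qed.

Lemma measurable_bad_cell k : measurable (bad_cell k).
Proof.
rewrite /bad_cell; case: ifP => // kM; have [g1 g2 g3] := grid_bounds kM.
apply: measurableU; last exact: measurable_double_flip.
apply: measurable_finite_fun => v; apply: measurable_snapshot ha _ _ (grid_in kM).
Qed.

Lemma measurable_bad_event : measurable bad_event.
Proof. by apply: measurable_bigU => k; exact: measurable_bad_cell. Qed.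

Lemma bad_event_le : (P bad_event <= (M%:R * (16 * n%:R ^+ 3 * expR (- l ^+ 2)
  + n%:R ^+ 4 * (C * (T / M%:R)) ^+ 2))%:E)%E.
Proof.
rewrite -[X in X%:R * _](size_iota 0 M); apply: union_bound.
  by move=> k; exact: measurable_bad_cell.
have b0 : 0 <= 16 * n%:R ^+ 3 * expR (- l ^+ 2) + n%:R ^+ 4 * (C * (T / M%:R)) ^+ 2.
  apply: addr_ge0; first by apply: mulr_ge0; last exact: expR_ge0.
  by apply: mulr_ge0; [exact: exprn_ge0|exact: sqr_ge0].
move=> k; rewrite /bad_cell; case: ifP => kM; last by rewrite measure0 lee_fin.
have [g1 g2 g3] := grid_bounds kM; have gk := grid_in kM.
have ms v : measurable (snapshot a (grid k) @^-1` [set v]).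
  exact: measurable_snapshot ha _ _ gk.
apply: le_trans (measureU2 _ _ _) _.
- exact: measurable_finite_fun.
- exact: measurable_double_flip.
rewrite EFinD; apply: leeD; last first.
  by rewrite -(grid_step k); exact: double_flip_le.
have law v := @snapshot_law _ _ _ _ _ _ _ _ _ _ ha _ _ v gk (edge_law gk).
have Pbad := prob_finite ms law (bad (p (grid k)) s l).
apply: (@le_trans _ _ (prob (p (grid k)) (bad (p (grid k)) s l))%:E).
  by rewrite le_eqVlt; apply/orP; left; apply/eqP; exact: Pbad.
rewrite lee_fin.
by apply: prob_bad => //; [exact: p_unit|apply: lt_le_trans s1].
Qed.

(** Compare with the snapshot at the left end of the cell of t: there the constant
    is 88, and 626 = 7 * 88 + 10 is what [regular_perturb] returns. *)
Lemma good_regular w t : ~ bad_event w -> t \in `[0, T] ->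
  regular (noise (p t) (snapshot a t w)) (p t) s l 626.
Proof.
move=> gw tT.
have t0T : 0 <= t <= T by move: tT; rewrite in_itv.
have [k kM /andP[kt tk]] := grid_cell t0T.
have [g1 g2 g3] := grid_bounds kM; have gk := grid_in kM.
have : ~ bad_cell k w.
  move=> bk; apply: gw; rewrite /bad_event -bigcup_seq; exists k => //.
  by rewrite /= mem_iota.
rewrite /bad_cell kM => /not_orP[/= /negP good nodouble].
have s0 : 0 < s by exact: lt_le_trans s1.
have reg := regular_noise (p_unit gk) s0 sn l1 s1 good.
set v := snapshot a t w; set vk := snapshot a (grid k) w in good reg.
have dp : `|p t - p (grid k)| <= (s ^+ 2 ^+ 2)^-1.
  rewrite sn; apply: le_trans Mbig.
  apply: le_trans (p_lipschitz g1 kt _) _; first by case/andP: t0T.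
  by rewrite ler_wpM2l// -(grid_step k) lerD2r.
have s21 : 1 <= s ^+ 2 by rewrite exprn_ege1.
have same e : v e != vk e -> flip (edge_process a e) (grid k) (grid k.+1) w.
  by move=> ve; exists t; [rewrite kt tk|move: ve; rewrite !ffunE].
have close i j : noise (p t) v i j = noise (p (grid k)) vk i j +
    (noise (p t) v i j - noise (p (grid k)) vk i j) by ring.
rewrite (_ : noise (p t) v = fun i j => noise (p (grid k)) vk i j +
    (noise (p t) v i j - noise (p (grid k)) vk i j)); last first.
  by apply/funext => i; apply/funext => j; exact: close.
have -> : 626 = 7 * 88 + 10 :> R by ring.
apply: regular_perturb reg => //.
- exact: p_unit.
- exact: p_unit.
- apply: le_trans dp _; rewrite lef_pV2 ?posrE ?exprn_gt0//.
  by rewrite expr2 ler_peMr//; lra.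
- by move=> i j; rewrite -close; apply: noise_le1; exact: p_unit.
(* at most one edge has changed since the last grid time *)
have [e1 he1] : exists e1, forall e, v e != vk e -> e = e1.
  have [[e1 h1]|h] := pselect (exists e, v e != vk e).
    exists e1 => e h; apply/eqP; apply: contrapT => /negP ne.
    by apply: nodouble; exact: double_flipP ne (same _ h) (same _ h1).
  by exists e0 => e he; case: h; exists e.
apply: (@le_trans _ _ (\sum_i \sum_j
    ((edge i j == e1)%:R + `|p t - p (grid k)|))).
  apply: ler_sum => i _; apply: ler_sum => j _.
  rewrite /noise /centered.
  have -> : (v (edge i j))%:R - p t - ((vk (edge i j))%:R - p (grid k)) =
    ((v (edge i j))%:R - (vk (edge i j))%:R) - (p t - p (grid k)) by ring.
  apply: le_trans (ler_normB _ _) _; rewrite lerD2r.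
  have [->|ne] := eqVneq (v (edge i j)) (vk (edge i j)); first by rewrite subrr normr0.
  rewrite (he1 _ ne) eqxx; case: (v e1); case: (vk e1);
    by rewrite ?subrr ?subr0 ?sub0r ?normrN ?normr0 ?normr1.
under eq_bigr do rewrite big_split /=.
rewrite big_split /= !sumr_const card_ord.
have h1 : \sum_i \sum_j (edge i j == e1)%:R <= 2 :> R.
  apply: le_trans (card_incident R e1); rewrite [leRHS]big_mkcond /=.
  apply: ler_sum => i _; rewrite -(sum_incident i (fun e => (e == e1)%:R)).
  case: ifP => ie.
    rewrite (bigD1 e1)//= eqxx big1 ?addr0// => e /andP[_ /negPf ->].
    by [].
  rewrite big1// => e ei; case: eqVneq => // ee; by rewrite ee ie in ei.
have h2 : `|p t - p (grid k)| *+ n *+ n <= 1.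
  rewrite -mulrnA -[leLHS]mulr_natl natrM -sn -expr2 mulrC -ler_pdivlMr ?exprn_gt0//.
  by rewrite mul1r.
by lra.
Qed.

End Cells.

(** * Orders of magnitude *)

Section Asymptotics.
Variable R : realType.

Lemma sqrtr_nat (N : nat) : Num.sqrt (N%:R : R) ^+ 2 = N%:R.
Proof. by rewrite sqr_sqrtr. Qed.

(** With r = N^(1/4), ln N is at most 4 r and sqrt N is r^2. *)
Lemma eventually_scales (c k X : R) : 0 < c -> 0 < k -> exists N0 : nat,
  forall N, (N0 <= N)%N ->
  [/\ (1 < N)%N, X <= N%:R, 1 <= Num.sqrt (N%:R : R), 12 <= ln (N%:R : R) &
      k * ln (N%:R : R) <= c * Num.sqrt N%:R].
Proof.
move=> c0 k0.
pose q := k * 4 / c.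
pose Y := 2 + `|X| + expR 12 + q ^+ 4.
exists (Num.truncn Y).+1 => N hN.
have q0 : 0 < q by rewrite divr_gt0// mulr_gt0.
have q4 : 0 <= q ^+ 4 by rewrite exprn_ge0// ltW.
have X0 := normr_ge0 X; have E0 := expR_gt0 (12 : R).
have YN : Y <= N%:R.
  apply: ltW; apply: lt_le_trans (truncnS_gt Y) _.
  by rewrite ler_nat.
have N2 : 2 <= N%:R :> R by rewrite /Y in YN; lra.
have N0 : 0 < N%:R :> R by lra.
set s := Num.sqrt _.
have s0 : 0 < s by rewrite sqrtr_gt0.
have sn : s ^+ 2 = N%:R by exact: sqrtr_nat.
have s1 : 1 <= s by rewrite -(@expr_ge1 _ 2) ?ltW// sn; lra.
set r := Num.sqrt s.
have r0 : 0 < r by rewrite sqrtr_gt0.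
have rs : r ^+ 2 = s by rewrite sqr_sqrtr// ltW.
have r4 : r ^+ 4 = N%:R by rewrite (exprM r 2 2) rs.
have qr : q <= r.
  rewrite -(@ler_pXn2r _ 4)// ?nnegrE ?ltW// r4.
  by rewrite /Y in YN; lra.
split.
- by rewrite -(ltr_nat R); lra.
- by have := ler_norm X; rewrite /Y in YN; lra.
- by [].
- rewrite -(expRK 12) ler_ln ?posrE ?expR_gt0//.
  by rewrite /Y in YN; lra.
have lr : ln (N%:R : R) <= 4 * r.
  rewrite -r4 lnXn//.
  rewrite -[leLHS]mulr_natl ler_pM2l//.
  by have := ln_sublinear r0; lra.
rewrite -rs; apply: (@le_trans _ _ (k * (4 * r))).
  by rewrite ler_pM2l.
have : k * 4 <= c * r by rewrite -ler_pdivrMl// mulrC.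
by rewrite expr2 mulrA => h; have := ler_wpM2r (ltW r0) h; lra.
Qed.

(** Telescoping, since 1 / k^2 is at most 2 / k - 2 / (k + 1). *)
Lemma sum_inv_sqr_le (K : R) (n : nat) : 0 <= K ->
  \sum_(0 <= k < n) (if (k == 0)%N then 0 else K / k%:R ^+ 2) <= 2 * K.
Proof.
move=> K0.
suff: \sum_(0 <= k < n) (if (k == 0)%N then 0 else K / k%:R ^+ 2)
   <= 2 * K - (if n is 0%N then 0 else 2 * K / n%:R).
  move=> /le_trans; apply; rewrite gerBl; case: n => // n.
  by rewrite divr_ge0// mulr_ge0.
elim: n => [|n IHn]; first by rewrite big_nil subr0 mulr_ge0.
rewrite big_nat_recr//=; case: n IHn => [|n] IHn /=.
  by rewrite big_nil addr0 divr1 subrr.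
apply: le_trans (lerD IHn (lexx _)) _ => /=.
rewrite -[n.+2%:R]natr1; have : 1 <= n.+1%:R :> R by rewrite ler1n.
move: (n.+1%:R : R) => y y1.
have -> : 2 * K - 2 * K / (y + 1) =
  2 * K - 2 * K / y + K / y ^+ 2 + K * (y - 1) / (y ^+ 2 * (y + 1)).
  by field; lra.
by rewrite lerDl divr_ge0 ?mulr_ge0 ?sqr_ge0//; lra.
Qed.

Lemma limn_esup_le (u : (\bar R)^nat) (b : \bar R) (n0 : nat) :
  (forall n, (n0 <= n)%N -> (u n <= b)%E) -> (limn_esup u <= b)%E.
Proof.
move=> ub; rewrite /limn_esup /limf_esup.
apply: (@le_trans _ _ (ereal_sup [set u x | x in [set n | (n0 <= n)%N]])).
  apply: ereal_inf_lbound => /=; exists [set n | (n0 <= n)%N] => //.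
  by exists n0.
by apply: ge_ereal_sup => _ [n hn <-]; exact: ub.
Qed.

End Asymptotics.

Lemma expR_ln_sqr (R : realType) (N : nat) : (0 < N)%N -> 12 <= ln (N%:R : R) ->
  expR (- ln (N%:R : R) ^+ 2) <= (N%:R ^+ 12)^-1.
Proof.
move=> N0 l12; have y0 : 0 < N%:R :> R by rewrite ltr0n.
rewrite -[N%:R ^+ 12](lnK (x := N%:R ^+ 12)) ?posrE ?exprn_gt0//.
rewrite -expRN ler_expR lerN2 lnXn// -[leLHS]mulr_natl expr2.
by rewrite ler_wpM2r//; lra.
Qed.

(** With N^6 cells, the bound of [bad_event_le] is summable in N. *)
Lemma bad_event_summand (R : realType) (N : nat) (D : R) : (0 < N)%N ->
  12 <= ln (N%:R : R) ->
  (N ^ 6)%:R * (16 * N%:R ^+ 3 * expR (- ln (N%:R : R) ^+ 2)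
     + N%:R ^+ 4 * (D / (N ^ 6)%:R) ^+ 2) <= (16 + D ^+ 2) / N%:R ^+ 2.
Proof.
move=> N0 l12; have zy := expR_ln_sqr N0 l12; rewrite natrX.
set z := expR _ in zy *.
have y1 : 1 <= N%:R :> R by rewrite ler1n.
set y : R := N%:R in y1 zy *.
have y0 : 0 < y by lra.
have -> : y ^+ 6 * (16 * y ^+ 3 * z + y ^+ 4 * (D / y ^+ 6) ^+ 2) =
  16 * (y ^+ 9 * z) + D ^+ 2 / y ^+ 2 by field; lra.
rewrite [leRHS]mulrDl lerD2r; apply: ler_wpM2l => //.
apply: (@le_trans _ _ (y ^+ 9 * (y ^+ 12)^-1)).
  by rewrite ler_wpM2l// exprn_ge0// ltW.
rewrite (_ : y ^+ 9 * (y ^+ 12)^-1 = (y ^+ 3)^-1); last by field; lra.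
rewrite lef_pV2 ?posrE ?exprn_gt0// [leRHS]exprS ler_peMl// exprn_ge0//; lra.
Qed.

Lemma expectation_error_le (R : realType) (N : nat) (s : R) : (0 < N)%N ->
  12 <= ln (N%:R : R) -> 1 <= s -> s ^+ 2 = N%:R ->
  5 * N%:R * (16 * N%:R ^+ 3 * expR (- ln (N%:R : R) ^+ 2))
    <= 80 * (ln (N%:R : R) ^+ 3 / s).
Proof.
move=> N0 l12 s1 sn; have zs := expR_ln_sqr N0 l12.
set z := expR _ in zs *.
have l31 : 1 <= ln (N%:R : R) ^+ 3 by rewrite exprn_ege1//; lra.
set l3 := ln _ ^+ 3 in l31 *; rewrite -sn in zs *.
have -> : 5 * s ^+ 2 * (16 * (s ^+ 2) ^+ 3 * z) = 80 * (s ^+ 8 * z) by ring.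
apply: ler_wpM2l => //.
apply: (@le_trans _ _ (s ^+ 8 * ((s ^+ 2) ^+ 12)^-1)).
  by rewrite ler_wpM2l// exprn_ge0//; lra.
apply: (@le_trans _ _ (1 / s)).
  rewrite (_ : s ^+ 8 * _ = (s ^+ 15)^-1 / s); last by field; lra.
  rewrite ler_wpM2r ?invr_ge0//; first lra.
  by rewrite invf_le1 ?exprn_gt0 ?exprn_ege1//; lra.
by rewrite ler_wpM2r ?invr_ge0//; lra.
Qed.

Theorem theorem3p2 (R : realType) (d : measure_display)
    (Omega : measurableType d) (P : probability Omega R)
    (T p0 lon loff : R)
    (a : forall N : nat, 'I_N -> 'I_N -> R -> Omega -> bool)
    (hT : 0 < T) (hp0 : 0 < p0 < 1) (hlon : 0 < lon) (hloff : 0 < loff)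
    (ha : forall N : nat, (0 < N)%N -> dynamic_ER P T p0 lon loff (a N)) :
  let mu (N : nat) (t : R) (w : Omega) : R :=
    principal_eigenvalue (adjacency (a N) t w) in
  exists OmegaN : nat -> set Omega,
    [/\ forall N, measurable (OmegaN N),
        exists eta : R, 0 < eta /\
          forall N : nat, (0 < N)%N ->
            (P (~` OmegaN N) <= (expR (- eta * ln (N%:R : R) ^+ 2))%:E)%E &
        exists G : nat -> R -> {RV P >-> R},
          (forall (N : nat) (w : Omega) (t : R),
             (0 < N)%N -> OmegaN N w -> t \in `[0, T] ->
             (mu N t w)%:E =
             ('E_P[mu N t] +
              (N%:R^-1 * (\sum_(i < N) \sum_(j < N)
                 ((a N i j t w)%:R - edge_prob P (a N i j) t)) +
               G N t w * (ln (N%:R : R) ^+ 4 / Num.sqrt (N%:R : R)))%:E)%E) /\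
          {ae P, forall w,
             (limn_esup (fun N : nat =>
                ereal_sup [set `|G N t w|%:E | t in `[0%R, T]%classic])
              < +oo)%E}].
Proof.
move=> mu.
have [|p [c [C [c0 C0 unif]]]] := on_off_uniform hT hp0 hlon hloff (P := P).
  by exists (edge_process (a 1%N) (edge ord0 ord0)); exact: edge_on_off (ha 1%N isT) _.
have pE N : (0 < N)%N -> forall e t, t \in `[0, T] ->
    P [set w | edge_process (a N) e t w] = (p t)%:E /\ c <= p t.
  by move=> N0 e t; have [+ _] := unif _ (edge_on_off (ha N N0) e); exact.
have flipE N : (0 < N)%N -> forall e s u, 0 <= s -> s <= u -> u <= T ->
    (P (flip (edge_process (a N) e) s u) <= (C * (u - s))%:E)%E.
  by move=> N0 e s u; have [_ +] := unif _ (edge_on_off (ha N N0) e); exact.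
have pb t : t \in `[0, T] -> c <= p t <= 1.
  exact: (p_bounds (isT : (0 < 1)%N) (ha 1%N isT) (pE 1%N isT)).
have p01 t : t \in `[0, T] -> 0 <= p t <= 1.
  by move=> /pb /andP[h ->]; rewrite (le_trans (ltW c0) h).
have c1 : c <= 1.
  have /andP[h1 h2] : c <= p 0 <= 1 by apply: pb; rewrite in_itv /= lexx ltW.
  exact: le_trans h2.
have [N0 hN0] := @eventually_scales R c (8 * 626) (C * T) c0 (mulr_gt0 (ltr0n _ 8) (ltr0n _ 626)).
pose s (N : nat) : R := Num.sqrt N%:R.
pose l (N : nat) : R := ln N%:R.
pose res N t w := residual (p t) (snapshot (a N) t w)
  - mean (p t) (residual (n := N) (p t)).
pose g N t w := if (1 < N)%N && (0 <= t <= T) then res N t w * (s N / l N ^+ 4) else 0.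
have mg N t : measurable_fun setT (g N t).
  rewrite /g; case E : ((1 < N)%N && (0 <= t <= T)); last exact: measurable_cst.
  have /andP[N1 tT] := E.
  have tT' : t \in `[0, T] by rewrite in_itv.
  apply: (@measurable_finite_map _ _ _ _ (snapshot (a N) t) _
    (fun v => (residual (p t) v - mean (p t) (residual (p t))) * (s N / l N ^+ 4))).
  by move=> v; apply: measurable_snapshot (ha N (ltnW N1)) _ _ tT'.
pose G N t : {RV P >-> R} := mfun_Sub (mem_set (mg N t)).
have GE N t w : G N t w = g N t w by [].
(* G is the exact normalised remainder for N >= 2, so the identity holds on the
   whole space and the content is that G stays bounded; for N = 1 the
   normalisation vanishes, and the bound exp 0 = 1 allows the empty event *)
exists (fun N => if (1 < N)%N then setT else set0); split.
- by move=> N; case: ifP.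
- exists 1; split=> // N N1; case: ltnP => hN.
    by rewrite setCT measure0 lee_fin expR_ge0.
  have -> : N = 1%N by apply/eqP; rewrite eqn_leq hN.
  by rewrite setC0 probability_setT ln1 expr0n mulr0 expR0.
exists G; split.
  move=> N w t Npos ON tT.
  have N1 : (1 < N)%N by move: ON; case: ifP.
  have adjacencyE w' : adjacency (a N) t w' = adj R (snapshot (a N) t w').
    by apply/matrixP => i j; rewrite !mxE (snapshot_edge (ha N Npos)).
  have Emu : ('E_P[mu N t])%E =
      (mean (p t) (fun v => principal_eigenvalue (adj R (n := N) v)))%:E.
    rewrite -(@expectation_finite _ _ _ P _ _ (snapshot (a N) t)).
    - by congr expectation; apply/funext => w'; rewrite /mu adjacencyE.
    - by move=> v; apply: measurable_snapshot (ha N Npos) _ _ tT.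
    - by move=> v; apply: (snapshot_law (ha N Npos)) => // e; have [] := pE N Npos e t tT.
  rewrite Emu -EFinD; congr EFin.
  rewrite (mean_principal N (p01 t tT)) /mu adjacencyE GE /g N1.
  have -> : 0 <= t <= T by move: tT; rewrite in_itv.
  have lN : l N != 0 by rewrite gt_eqF// ln_gt0// ltr1n.
  have sN : s N != 0 by rewrite gt_eqF// sqrtr_gt0 ltr0n.
  have -> : \sum_(i < N) \sum_(j < N) ((a N i j t w)%:R - edge_prob P (a N i j) t) =
      \sum_i walks (noise (p t) (snapshot (a N) t w)) 1 i.
    apply: eq_bigr => i _; rewrite walks1; apply: eq_bigr => j _.
    rewrite /noise /centered (snapshot_edge (ha N Npos))//; congr (_ - _).
    rewrite /edge_prob; have [pe _] := pE N Npos (edge i j) t tT.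
    rewrite (_ : [set w | a N i j t w] = [set w | edge_process (a N) (edge i j) t w]).
      by rewrite pe.
    apply/seteqP; split=> w' /=;
      by rewrite -(snapshot_edge (ha N Npos) w' i j tT) ffunE.
  rewrite /= -/(s N) -/(l N).
  have -> : res N t w * (s N / l N ^+ 4) * (l N ^+ 4 / s N) = res N t w.
    by field; apply/andP.
  rewrite /res /residual; set m := mean _ _; ring.
pose Bad N := if (N0 <= N)%N then bad_event T (a N) p (N ^ 6) (s N) (l N) else set0.
have scale N : (N0 <= N)%N -> [/\ (0 < N)%N, 1 <= s N, s N ^+ 2 = N%:R, 12 <= l N &
    [/\ 8 * 626 * l N <= c * s N, 1 <= l N & C * (T / (N ^ 6)%:R) <= (N%:R ^+ 2)^-1]].
  move=> /hN0[N1 XN s1 l12 small]; split=> //; first exact: ltnW.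
    exact: sqrtr_nat.
  split=> //; first by apply: le_trans l12; rewrite ler1n.
  have y1 : 1 <= N%:R :> R by rewrite ler1n ltnW.
  rewrite natrX mulrA ler_pdivrMr ?exprn_gt0//; last lra.
  rewrite (_ : (N%:R ^+ 2)^-1 * N%:R ^+ 6 = N%:R ^+ 4); last by field; lra.
  apply: le_trans XN _; rewrite exprS ler_peMr ?exprn_ege1//; lra.
have mBad N : measurable (Bad N).
  rewrite /Bad; case: ifP => // /scale[Npos s1 sn l12 [_ _ _]].
  apply: (measurable_bad_event hT (ha N Npos)).
  by rewrite expn_gt0 Npos.
pose K := 16 + (C * T) ^+ 2.
have K0 : 0 <= K by rewrite addr_ge0 ?sqr_ge0.
have PBad N : (P (Bad N) <= (if (N == 0)%N then 0 else K / N%:R ^+ 2)%:E)%E.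
  rewrite /Bad; case: ifP => [/scale[Npos s1 sn l12 [_ l1 _]]|_]; last first.
    by rewrite measure0 lee_fin; case: eqP => // _; rewrite divr_ge0 ?sqr_ge0.
  rewrite eqn0Ngt Npos /=.
  apply: le_trans (bad_event_le hT Npos (ha N Npos) c0 (pE N Npos) (flipE N Npos) _ s1 sn l1) _.
    by rewrite expn_gt0 Npos.
  rewrite lee_fin; apply: le_trans (bad_event_summand (C * T) Npos l12).
  by rewrite (mulrA C).
have sumBad : (\sum_(N <oo) P (Bad N) < +oo)%E.
  apply: (@le_lt_trans _ _ (2 * K)%:E); last exact: ltry.
  apply: lime_le; first by apply: is_cvg_nneseries.
  apply: nearW => n.
  apply: (@le_trans _ _ (\sum_(0 <= k < n)
     (if (k == 0)%N then 0 else K / k%:R ^+ 2))%:E).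
    by rewrite -sumEFin; apply: lee_sum => N _; exact: PBad.
  by rewrite lee_fin; exact: sum_inv_sqr_le.
have nullBad := lim_sup_set_cvg0 mBad sumBad.
exists (lim_sup_set Bad); split=> //.
  by apply: bigcap_measurableType => k _; apply: bigcup_measurable => j _; exact: mBad.
move=> w /=; apply: contra_notP => nbad.
have [n1 hn1] : exists n1, forall N, (n1 <= N)%N -> ~ Bad N w.
  apply: contrapT => /forallNP h; apply: nbad => n1 _.
  have := h n1 => /existsNP[N /not_implyP[nN /contrapT bN]].
  by exists N.
pose k (x : R) := 15 * x ^+ 2 / c ^+ 2.
have k0 x : 0 <= k x by rewrite divr_ge0 ?sqr_ge0// mulr_ge0 ?sqr_ge0.
pose K1 := k 626; pose K2 := k 88.
have K3 : 0 <= K1 + (K2 + 80) by rewrite addr_ge0 ?k0// addr_ge0 ?k0.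
apply: (@le_lt_trans _ _ (K1 + (K2 + 80))%:E); last exact: ltry.
apply: (@limn_esup_le R _ _ (maxn n1 N0)) => N; rewrite geq_max => /andP[n1N N0N].
have [Npos s1 sn l12 [small l1 Mbig]] := scale N N0N.
have good : ~ bad_event T (a N) p (N ^ 6) (s N) (l N) w.
  by have := hn1 N n1N; rewrite /Bad N0N.
apply: ge_ereal_sup => _ [t tT <-]; rewrite lee_fin.
change (`|g N t w| <= K1 + (K2 + 80)); rewrite /g.
have tT' : t \in `[0, T] by [].
have -> : 0 <= t <= T by move: tT'; rewrite in_itv.
rewrite andbT; case: ifP => [N1|_]; last first.
  by rewrite normr0.
have s0 : 0 < s N := lt_le_trans ltr01 s1.
have l0 : 0 < l N := lt_le_trans ltr01 l1.
have /andP[cp p1] := pb t tT'.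
have MN : (0 < N ^ 6)%N by rewrite expn_gt0 Npos.
have reg := good_regular hT Npos (ha N Npos) c0 C0 (pE N Npos) (flipE N Npos) MN s1 sn l1 Mbig good tT'.
(* the value of the remainder on the good event *)
have h1 : `|residual (p t) (snapshot (a N) t w)| <= K1 * (l N ^+ 3 / s N).
  by apply: (residual_small (K := 626) Npos s0 sn l1 _ c0 c1 cp small reg); rewrite ler1n.
have e0 : 0 <= l N ^+ 3 / s N by rewrite divr_ge0 ?exprn_ge0 ?(le_trans ler01).
(* its mean, bounded through the good event at the single time t *)
have h2 : `|mean (p t) (residual (n := N) (p t))| <= (K2 + 80) * (l N ^+ 3 / s N).
  have e1 : 0 <= K2 * (l N ^+ 3 / s N) by rewrite mulr_ge0// k0.
  have small88 : 8 * 88 * l N <= c * s N.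
    apply: le_trans small; apply: ler_wpM2r; first exact: le_trans l1.
    by rewrite ler_wpM2l// ler_nat.
  have K88 : 1 <= 88 :> R by rewrite ler1n.
  have r1 (v : {ffun edges N -> bool}) : ~~ bad (p t) (s N) (l N) v -> `|residual (p t) v| <= K2 * (l N ^+ 3 / s N).
    move=> gv; have regv := regular_noise (p01 t tT') s0 sn l1 s1 gv.
    exact: (residual_small Npos s0 sn l1 K88 c0 c1 cp small88 regv).
  apply: (le_trans (@mean_residual R N Npos (p t) _ _ (p01 t tT') e1 r1)).
  rewrite [leRHS]mulrDl lerD2l.
  apply: le_trans (expectation_error_le Npos l12 s1 sn).
  rewrite ler_wpM2l ?mulr_ge0//.
  exact: (prob_bad (p01 t tT') s0 sn l1).
rewrite normrM (ger0_norm (_ : 0 <= s N / l N ^+ 4)); last first.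
  by apply: divr_ge0; [exact: ltW|exact/exprn_ge0/ltW].
rewrite mulrA ler_pdivrMr ?exprn_gt0//.
have h3 := le_trans (ler_normB _ _) (lerD h1 h2).
rewrite -mulrDl in h3.
apply: le_trans (ler_wpM2r (ltW s0) h3) _.
rewrite (_ : _ * (l N ^+ 3 / s N) * s N = (K1 + (K2 + 80)) * l N ^+ 3); last by field; rewrite gt_eqF.
apply: ler_wpM2l => //.
by rewrite [leRHS]exprS ler_peMl//; exact/exprn_ge0/ltW.
Qed.
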